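(* Let $\mathbb{T}$ be a time scale with $\sup\mathbb{T}=+\infty$ and bounded graininess, and let $A$ be a real $n\times n$ matrix. The system $x^\Delta=Ax$ on $\mathbb{T}$ is uniformly exponentially stable if and only if $\operatorname{spec}(A)\subset\mathcal{S}_\mathbb{T}$.
   Context: A system $x^\Delta=Ax$ (with $x$ real or complex) on a time scale $\mathbb{T}$ is uniformly exponentially stable if there exist $K\ge1$, $\alpha>0$ and an open neighborhood $V$ of $0$ such that for all $t_0\le t$ in $\mathbb{T}$ and all $x_0\in V$ the solution with $x(t_0)=x_0$ satisfies $\|x(t)\|\le Ke^{-\alpha(t-t_0)}\|x_0\|$. Here $x^\Delta$ is the delta derivative on $\mathbb{T}$. $\mathcal{S}_\mathbb{T}$ is the set of $\lambda\in\mathbb{C}$ for which the scalar equation $x^\Delta=\lambda x$ on $\mathbb{T}$ is uniformly exponentially stable. $\operatorname{spec}(A)$ is the set of (complex) eigenvalues of $A$. *)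

(* Defs.v *)
From Stdlib Require Import Reals Lra.
Open Scope R_scope.

Definition C := (R * R)%type.
Definition C0 : C := (0, 0).
Definition RtoC (r : R) : C := (r, 0).
Definition Cadd (z w : C) : C := (fst z + fst w, snd z + snd w).
Definition Copp (z : C) : C := (- fst z, - snd z).
Definition Csub (z w : C) : C := Cadd z (Copp w).
Definition Cmul (z w : C) : C :=
  (fst z * fst w - snd z * snd w, fst z * snd w + snd z * fst w).
Definition Cnorm2 (z : C) : R := fst z * fst z + snd z * snd z.
Definition Cabs (z : C) : R := sqrt (Cnorm2 z).

(** Vectors of C^n: functions nat -> C, only indices i < n are meaningful. *)
Definition vec := nat -> C.
Definition mxC := nat -> nat -> C.
Definition mxR := nat -> nat -> R.

Fixpoint sumR (n : nat) (f : nat -> R) : R :=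
  match n with O => 0 | S k => sumR k f + f k end.
Fixpoint sumC (n : nat) (f : nat -> C) : C :=
  match n with O => C0 | S k => Cadd (sumC k f) (f k) end.

Definition vnorm (n : nat) (v : vec) : R := sqrt (sumR n (fun i => Cnorm2 (v i))).
Definition vsub (v w : vec) : vec := fun i => Csub (v i) (w i).
Definition vscale (r : R) (v : vec) : vec := fun i => Cmul (RtoC r) (v i).
Definition vzero : vec := fun _ => C0.
Definition mulmxv (n : nat) (M : mxC) (v : vec) : vec :=
  fun i => sumC n (fun j => Cmul (M i j) (v j)).
Definition mxRtoC (A : mxR) : mxC := fun i j => RtoC (A i j).

Definition time_scale (T : R -> Prop) : Prop :=
  (exists t, T t) /\
  (forall x, (forall eps, 0 < eps -> exists y, T y /\ Rabs (y - x) < eps) -> T x).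

Definition sup_infinite (T : R -> Prop) : Prop :=
  forall M, exists t, T t /\ M < t.

Definition is_inf (E : R -> Prop) (m : R) : Prop :=
  (forall u, E u -> m <= u) /\ (forall m', (forall u, E u -> m' <= u) -> m' <= m).

Definition forward_jump (T : R -> Prop) (t s : R) : Prop :=
  is_inf (fun u => T u /\ t < u) s.

Definition bounded_graininess (T : R -> Prop) : Prop :=
  exists M, forall t s, T t -> forward_jump T t s -> s - t <= M.

Definition delta_deriv (n : nat) (T : R -> Prop) (f : R -> vec) (t : R) (a : vec) : Prop :=
  exists st, forward_jump T t st /\
    forall eps, 0 < eps -> exists delta, 0 < delta /\
      forall s, T s -> Rabs (t - s) < delta ->
        vnorm n (vsub (vsub (f st) (f s)) (vscale (st - s) a)) <= eps * Rabs (st - s).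

Definition Tfrom (T : R -> Prop) (t0 : R) : R -> Prop := fun s => T s /\ t0 <= s.

Definition is_solution (n : nat) (T : R -> Prop) (M : mxC) (t0 : R) (x0 : vec)
    (x : R -> vec) : Prop :=
  (forall i, (i < n)%nat -> x t0 i = x0 i) /\
  (forall t, Tfrom T t0 t -> delta_deriv n (Tfrom T t0) x t (mulmxv n M (x t))).

Definition open_set (n : nat) (V : vec -> Prop) : Prop :=
  forall v, V v -> exists r, 0 < r /\ forall w, vnorm n (vsub w v) < r -> V w.

Definition UES (n : nat) (T : R -> Prop) (M : mxC) : Prop :=
  exists K alpha (V : vec -> Prop),
    1 <= K /\ 0 < alpha /\ open_set n V /\ V vzero /\
    forall t0 t x0 x, T t0 -> T t -> t0 <= t -> V x0 ->
      is_solution n T M t0 x0 x ->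
      vnorm n (x t) <= K * exp (- alpha * (t - t0)) * vnorm n x0.

Definition stability_set (T : R -> Prop) (lam : C) : Prop :=
  UES 1 T (fun _ _ => lam).

Definition eigenvalue (n : nat) (A : mxR) (lam : C) : Prop :=
  exists v : vec, (exists i, (i < n)%nat /\ v i <> C0) /\
    forall i, (i < n)%nat -> mulmxv n (mxRtoC A) v i = Cmul lam (v i).

(* Main.v *)
(** For the hard direction, Cayley-Hamilton gives eigenvalues [lam_1, ..., lam_m]
    of [A] with [(A - lam_1) ... (A - lam_m) = 0].  If [u] solves [u^Delta = A u],
    then so does every [u_k = (A - lam_1) ... (A - lam_k) u]; moreover [u_m = 0] and
    [u_(k-1)^Delta = lam_k u_(k-1) + u_k].  Descending on [k], it suffices that
    a scalar equation [y^Delta = lam y + g] with [lam] in the stability set and [g]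
    exponentially decaying has exponentially decaying solutions, uniformly in
    the initial time.  Restarting the unforced equation at the left end of
    a window of fixed length, a crude Gronwall estimate shows that [|y|] is halved
    across the window up to the size of [g].

    The stability set only constrains solutions that exist, so the unforced scalar
    equation must be solved: Euler polygons whose one-step relative error is at most [e]
    exist by induction along the time scale and, by Gronwall, converge as
    [e] tends to 0.

    Conversely, if [A v = lam v], a scalar solution [y] yields the solution [y v]. *)

From Stdlib Require Import Reals Lra Lia List Classical ClassicalChoice.
From mathcomp Require all_boot all_algebra complex Rstruct.
Require Import Defs.
From Coquelicot Require Import Complex.
Open Scope R_scope.

(** * Eigenvalues and the Cayley-Hamilton theorem *)

Definition vshift (n : nat) (M : mxC) (lam : Defs.C) (v : vec) : vec :=
  fun i => Csub (mulmxv n M v i) (Cmul lam (v i)).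

Module CayleyHamilton.
Import all_boot all_algebra.
Import complex Rstruct.
Import GRing.Theory.
Local Open Scope ring_scope.

Definition toC (z : R[i]) : Defs.C := (Re z, Im z).
Definition ofC (z : Defs.C) : R[i] := Complex (fst z) (snd z).

Lemma toCK : cancel toC ofC. Proof. by case. Qed.
Lemma ofCK : cancel ofC toC. Proof. by case. Qed.

Lemma ofC_add z w : ofC (Cadd z w) = ofC z + ofC w. Proof. by []. Qed.
Lemma ofC_mul z w : ofC (Cmul z w) = ofC z * ofC w. Proof. by []. Qed.
Lemma ofC_sub z w : ofC (Csub z w) = ofC z - ofC w. Proof. by []. Qed.

Lemma ofC_sum n (f : nat -> Defs.C) :
  ofC (sumC n f) = \sum_(j < n) ofC (f j).
Proof.
elim: n => [|n IHn]; first by rewrite big_ord0.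
by rewrite big_ord_recr /= ofC_add IHn.
Qed.

Definition row_of n (v : vec) : 'rV[R[i]]_n := \row_j ofC (v j).
(* Transposed, since MathComp's eigenvectors are row vectors. *)
Definition mat_of n (A : mxR) : 'M[R[i]]_n := \matrix_(i, j) ofC (Defs.RtoC (A j i)).

Lemma row_of_mul n A v :
  row_of n (mulmxv n (mxRtoC A) v) = row_of n v *m mat_of n A.
Proof.
apply/rowP => j; rewrite !mxE ofC_sum; apply: eq_bigr => k _.
by rewrite !mxE ofC_mul mulrC.
Qed.

Lemma row_of_shift n A lam v :
  row_of n (vshift n (mxRtoC A) lam v) = row_of n v *m (mat_of n A - (ofC lam)%:M).
Proof.
rewrite mulmxBr -row_of_mul mul_mx_scalar; apply/rowP => j.
by rewrite !mxE ofC_sub ofC_mul.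
Qed.

(** [fold_left] applies the head of the list first. On row vectors, which are multiplied from the
    right, the head is the leftmost factor, so the product keeps the order of the list. *)
Lemma row_of_fold n A (ls : seq R[i]) v :
  row_of n.+1 (fold_left (fun w lam => vshift n.+1 (mxRtoC A) lam w) (map toC ls) v) =
  row_of n.+1 v *m \prod_(z <- ls) (mat_of n.+1 A - z%:M).
Proof.
elim: ls v => [|z ls IHls] v /=; first by rewrite big_nil mulmx1.
by rewrite IHls row_of_shift toCK big_cons mulmxA.
Qed.

Lemma eigenvalue_of n A z : mxalgebra.eigenvalue (mat_of n A) z ->
  Defs.eigenvalue n A (toC z).
Proof.
case/eigenvalueP => v vA vN0.
(* A left eigenvector of the transpose, read as a column; entries outside ['I_n] default to 0. *)
pose w : vec := fun j => if insub j is Some k then toC (v 0 k) else Defs.C0.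
have wE (k : 'I_n) : w k = toC (v 0 k) by rewrite /w valK.
have rw : row_of n w = v by apply/rowP => k; rewrite mxE wE toCK.
exists w; split.
  case/rV0Pn: vN0 => k vk; exists k; split; first exact/ltP.
  rewrite wE => /(congr1 ofC); rewrite toCK => v0; case/eqP: vk; exact: v0.
move=> k /ltP ltkn; pose k' := Ordinal ltkn.
apply: (can_inj ofCK); rewrite ofC_mul toCK.
have := congr1 (fun u : 'rV_n => u 0 k') (row_of_mul n A w).
by rewrite rw vA !mxE /= => ->; rewrite -rw mxE.
Qed.

(** Over the complex numbers the characteristic polynomial splits. Its roots, listed with
    multiplicity, are eigenvalues, and evaluating its factorization at the matrix gives 0 by
    Cayley-Hamilton. *)
Lemma annihilating_eigenvalues n A : exists ls : list Defs.C,
  (forall lam, List.In lam ls -> Defs.eigenvalue n A lam) /\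
  forall v k, (k < n)%coq_nat ->
    fold_left (fun w lam => vshift n (mxRtoC A) lam w) ls v k = Defs.C0.
Proof.
(* For [n = 0] there are no coordinates to check; in size [n.+1] square matrices form a nontrivial
   ring. *)
case: n => [|n]; first by exists [::]; split=> // v k /ltP.
have [r chiE] := closed_field_poly_normal (char_poly (mat_of n.+1 A)).
rewrite (monicP (char_poly_monic _)) scale1r in chiE.
exists (map toC r); split.
  move=> lam /in_map_iff [z [<- zr]]; apply: eigenvalue_of.
  rewrite eigenvalue_root_char chiE root_prod_XsubC.
  elim: r zr {chiE} => //= y r IHr [->|/IHr zr]; rewrite inE ?eqxx // zr orbT //.
move=> v k /ltP ltkn; apply: (can_inj ofCK).
have := congr1 (fun u : 'rV_n.+1 => u 0 (Ordinal ltkn)) (row_of_fold n A r v).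
rewrite mxE /= => ->.
have -> : \prod_(z <- r) (mat_of n.+1 A - z%:M) = 0.
  rewrite -(Cayley_Hamilton (mat_of n.+1 A)) chiE rmorph_prod.
  by apply: eq_bigr => z _; rewrite rmorphB /= horner_mx_X horner_mx_C.
by rewrite mulmx0 mxE.
Qed.

End CayleyHamilton.

(** * Forward jumps and induction along a time scale *)

Definition closedT (T : R -> Prop) : Prop :=
  forall x, (forall eps, 0 < eps -> exists y, T y /\ Rabs (y - x) < eps) -> T x.

(* [b] is reached from [a] either by a small step or by the jump out of
   a right-scattered [a]. *)
Definition near (T : R -> Prop) (a delta b : R) : Prop :=
  T b /\ a < b /\ (b < a + delta \/ forward_jump T a b).

Lemma is_inf_unique E m m' : is_inf E m -> is_inf E m' -> m = m'.
Proof. intros [H1 H2] [H3 H4]. apply Rle_antisym; auto. Qed.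

Lemma is_inf_exists (E : R -> Prop) lb :
  (exists x, E x) -> (forall x, E x -> lb <= x) -> exists m, is_inf E m.
Proof.
intros [x Ex] Hlb.
destruct (completeness (fun y => E (- y))) as [m [Hm1 Hm2]].
- exists (- lb). intros y Hy. specialize (Hlb _ Hy). lra.
- exists (- x). now rewrite Ropp_involutive.
- exists (- m). split.
  + intros u Hu. assert (- u <= m); [|lra]. apply Hm1. now rewrite Ropp_involutive.
  + intros m' Hm'. assert (m <= - m'); [|lra].
    apply Hm2. intros y Hy. specialize (Hm' _ Hy). lra.
Qed.

Lemma forward_jump_exists T t : sup_infinite T -> exists s, forward_jump T t s.
Proof.
intros Hs. destruct (Hs t) as [u Hu].
apply is_inf_exists with t; [now exists u|intros x Hx; lra].
Qed.

Lemma forward_jump_ge T t s : forward_jump T t s -> t <= s.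
Proof. intros [_ H]. apply H. intros u Hu. lra. Qed.

Lemma forward_jump_from T t0 t s :
  t0 <= t -> forward_jump (Tfrom T t0) t s <-> forward_jump T t s.
Proof.
intros H. unfold forward_jump, Tfrom, is_inf.
split; intros [H1 H2]; split.
- intros u Hu. apply H1. intuition lra.
- intros m' Hm. apply H2. intros u Hu. apply Hm. tauto.
- intros u Hu. apply H1. tauto.
- intros m' Hm. apply H2. intros u Hu. apply Hm. intuition lra.
Qed.

Lemma forward_jump_dense T t : forward_jump T t t ->
  forall delta, 0 < delta -> exists b, T b /\ t < b < t + delta.
Proof.
intros [H1 H2] d Hd. apply NNPP. intros Hn.
assert (t + d <= t); [|lra]. apply H2. intros u [Hu Htu].
destruct (Rle_dec (t + d) u); [easy|]. exfalso. apply Hn. exists u. split; [easy|lra].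
Qed.

Lemma forward_jump_closed T t s : closedT T -> T t -> forward_jump T t s -> T s.
Proof.
intros HT Ht [H1 H2]. apply HT. intros eps He. apply NNPP. intros Hn.
assert (s + eps <= s); [|lra]. apply H2. intros u [Hu Htu].
destruct (Rle_dec (s + eps) u); [easy|]. exfalso. apply Hn. exists u. split; [easy|].
specialize (H1 u (conj Hu Htu)). rewrite Rabs_pos_eq; lra.
Qed.

Lemma sup_in_closed T (t0 u : R) : closedT T -> T t0 -> t0 <= u ->
  exists s, T s /\ t0 <= s <= u /\ forall b, T b -> b <= u -> b <= s.
Proof.
intros HT Ht0 Hu.
destruct (completeness (fun y => T y /\ y <= u)) as [m [Hm1 Hm2]].
- exists u. intros y Hy. lra.
- now exists t0.
- exists m. assert (t0 <= m) by (now apply Hm1).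
  assert (m <= u) by (apply Hm2; intros y Hy; lra).
  split; [|split; [lra|intros b Hb Hbu; now apply Hm1]].
  apply HT. intros eps He. apply NNPP. intros Hn.
  assert (m <= m - eps); [|lra]. apply Hm2. intros y [Hy Hyu].
  destruct (Rle_dec y (m - eps)); [easy|]. exfalso. apply Hn.
  exists y. split; [easy|]. assert (y <= m) by (now apply Hm1).
  rewrite Rabs_left1; lra.
Qed.

(** The supremum [m] of the times up to which [P] holds throughout lies in [T] by closedness. The
    left-limit hypothesis gives [P m], and if [m < t1] the right step would carry [P] past [m]. *)
Lemma ts_induction T t0 t1 (P : R -> Prop) :
  closedT T -> T t0 -> T t1 -> t0 <= t1 -> P t0 ->
  (forall a, T a -> t0 <= a < t1 -> P a ->
     exists delta, 0 < delta /\ forall b, near T a delta b -> b <= t1 -> P b) ->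
  (forall a, T a -> t0 < a <= t1 ->
     (forall delta, 0 < delta -> exists b, T b /\ t0 <= b /\ a - delta < b < a) ->
     (forall b, T b -> t0 <= b < a -> P b) -> P a) ->
  P t1.
Proof.
intros HT Ht0 Ht1 H01 HP0 Hr Hl.
set (E := fun s => T s /\ t0 <= s <= t1 /\ forall u, T u -> t0 <= u <= s -> P u).
assert (E0 : E t0).
{ split; [easy|]. split; [lra|]. intros u Hu Hu'. now replace u with t0 by lra. }
destruct (completeness E) as [m [Hm1 Hm2]].
- exists t1. intros y Hy. destruct Hy. lra.
- now exists t0.
- assert (H0m : t0 <= m) by now apply Hm1.
  assert (Hm1' : m <= t1) by (apply Hm2; intros y Hy; destruct Hy; lra).
  assert (Hden : forall eps, 0 < eps -> exists y, E y /\ m - eps < y <= m).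
  { intros eps He. apply NNPP. intros Hn.
    assert (m <= m - eps); [|lra]. apply Hm2. intros y Hy.
    destruct (Rle_dec y (m - eps)); [easy|]. exfalso. apply Hn.
    exists y. split; [easy|]. assert (y <= m) by now apply Hm1. lra. }
  assert (Tm : T m).
  { apply HT. intros eps He. destruct (Hden eps He) as [y [[Hy _] Hy2]].
    exists y. split; [easy|]. rewrite Rabs_left1; lra. }
  assert (Hbelow : forall u, T u -> t0 <= u < m -> P u).
  { intros u Hu Hum. destruct (Hden (m - u)) as [y [[_ [_ Hy]] Hy2]]; [lra|].
    apply Hy; [easy|lra]. }
  assert (Em : E m).
  { split; [easy|]. split; [lra|].
    destruct (classic (E m)) as [[_ [_ H]]|Hn]; [easy|].
    (* Were [m] outside [E], the elements of [E] near [m] would all lie strictly below it, so [m]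
       would be left-dense. *)
    assert (Pm : P m).
    { assert (t0 <> m) by (intros ->; easy).
      apply Hl; [easy|lra| |easy]. intros d Hd.
      destruct (Hden d Hd) as [y [Hy Hy2]]. exists y.
      destruct Hy as [Hy Hy']. split; [easy|]. split; [lra|].
      split; [lra|]. destruct (Req_dec y m); [|lra]. subst y.
      now exfalso; apply Hn. }
    intros u Hu Hum. destruct (Req_dec u m); [now subst u|apply Hbelow; [easy|lra]]. }
  destruct (Req_dec m t1) as [<-|Hne]; [apply Em; [easy|lra]|exfalso].
  assert (Hmt : m < t1) by lra.
  destruct Em as [_ [_ HE]].
  destruct (Hr m Tm (conj H0m Hmt) (HE m Tm ltac:(lra))) as [d [Hd Hstep]].
  destruct (is_inf_exists (fun u => T u /\ m < u) m) as [s Hs].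
  { now exists t1. } { intros x Hx; lra. }
  pose proof (forward_jump_ge _ _ _ Hs) as Hms.
  assert (Hnew : forall b, T b -> m < b <= t1 ->
    (forall u, T u -> m < u <= b -> P u) -> False).
  { intros b Hb Hmb Hu. assert (b <= m); [|lra]. apply Hm1.
    split; [easy|]. split; [lra|]. intros u Tu Hu'.
    destruct (Rle_dec u m); [apply HE; [easy|lra]|apply Hu; [easy|lra]]. }
  (* If [m] is right-dense, all points up to some [b] within [d] are reached by small steps; if it
     is right-scattered, its jump [s] is the only point of [T] in the interval from [m] (excluded)
     to [s]. *)
  destruct (Req_dec m s) as [<-|Hne2].
  + destruct (forward_jump_dense _ _ Hs (Rmin d (t1 - m))) as [b [Tb Hb]].
    { apply Rmin_pos; lra. }
    pose proof (Rmin_l d (t1 - m)). pose proof (Rmin_r d (t1 - m)).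
    apply (Hnew b Tb); [lra|]. intros u Tu Hu. apply Hstep; [|lra].
    split; [easy|]. split; [lra|]. left; lra.
  + assert (Ts : T s) by (apply (forward_jump_closed _ _ _ HT Tm Hs)).
    assert (s <= t1) by (now apply Hs).
    apply (Hnew s Ts); [lra|]. intros u Tu Hu.
    assert (s <= u) by (apply Hs; split; [easy|lra]).
    replace u with s by lra. apply Hstep; [|easy].
    split; [easy|]. split; [lra|]. now right.
Qed.

(** * A Gronwall inequality on time scales *)

Lemma exp_monotone x y : x <= y -> exp x <= exp y.
Proof. intros [H| ->]; [left; now apply exp_increasing|lra]. Qed.

(** Induction along [T]: a right step of any size [h], jumps included, is absorbed by
    [1 + L * h <= exp (L * h)], and at left-dense points [d] cannot jump upwards. The slack [eta] in
    the growth rate lets derivative estimates be used directly. *)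
Lemma gronwall T t0 t1 (d : R -> R) L G :
  closedT T -> T t0 -> T t1 -> t0 <= t1 -> 0 <= L -> 0 <= G -> 0 <= d t0 ->
  (forall a, T a -> t0 <= a < t1 -> forall eta, 0 < eta ->
     exists delta, 0 < delta /\ forall b, near T a delta b -> b <= t1 ->
       d b <= d a + (b - a) * (L * d a + G + eta)) ->
  (forall a, T a -> t0 < a <= t1 -> forall eta, 0 < eta ->
     exists delta, 0 < delta /\ forall b, T b -> t0 <= b < a -> a - b < delta ->
       d a <= d b + eta) ->
  d t1 <= (d t0 + G * (t1 - t0)) * exp (L * (t1 - t0)).
Proof.
intros HT Ht0 Ht1 H01 HL HG Hd0 Hr Hl.
(* First keep [eta] fixed as additional forcing; it tends to 0 at the end. *)
assert (Heta : forall eta, 0 < eta ->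
  d t1 <= (d t0 + (G + eta) * (t1 - t0)) * exp (L * (t1 - t0))).
{ intros eta He.
  apply (ts_induction T t0 t1
    (fun t => d t <= (d t0 + (G + eta) * (t - t0)) * exp (L * (t - t0)))); try easy.
  - replace (t0 - t0) with 0 by ring. rewrite !Rmult_0_r, exp_0. lra.
  - intros a Ta Ha Pa. destruct (Hr a Ta Ha eta He) as [del [Hdel Hb]].
    exists del. split; [easy|]. intros b Hn Hb1.
    apply Rle_trans with (1 := Hb b Hn Hb1).
    destruct Hn as [_ [Hab _]].
    replace (L * (b - t0)) with (L * (a - t0) + L * (b - a)) by ring.
    rewrite exp_plus.
    set (h := b - a) in *. assert (Hh : 0 < h) by (unfold h; lra).
    replace (b - t0) with ((a - t0) + h) by (unfold h; ring).
    assert (H1 : 1 + L * h <= exp (L * h)) by apply exp_ineq1_le.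
    assert (H2 : 1 + L * (a - t0) <= exp (L * (a - t0))) by apply exp_ineq1_le.
    set (X := exp (L * (a - t0))) in *. set (Y := exp (L * h)) in *.
    assert (1 <= X) by nra. assert (0 <= L * h) by nra.
    set (W := (d t0 + (G + eta) * (a - t0)) * X) in *.
    assert (0 <= W).
    { unfold W. apply Rmult_le_pos; [|lra].
      assert (0 <= (G + eta) * (a - t0)) by (apply Rmult_le_pos; lra). lra. }
    replace ((d t0 + (G + eta) * (a - t0 + h)) * (X * Y))
      with (W * Y + (G + eta) * h * (X * Y)) by (unfold W; ring).
    assert (1 <= X * Y) by nra.
    assert ((G + eta) * h * 1 <= (G + eta) * h * (X * Y)).
    { apply Rmult_le_compat_l; [apply Rmult_le_pos; lra|easy]. }
    assert (W * (1 + L * h) <= W * Y) by (apply Rmult_le_compat_l; easy).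
    assert (d a * (1 + L * h) <= W * (1 + L * h)) by (apply Rmult_le_compat_r; lra).
    lra.
  - intros a Ta Ha Hd Hp. apply le_epsilon. intros e Hepos.
    destruct (Hl a Ta Ha e Hepos) as [del [Hdel Hb]].
    destruct (Hd del Hdel) as [b [Tb [H0b Hba]]].
    apply Rle_trans with (d b + e); [apply Hb; try easy; lra|].
    apply Rplus_le_compat_r. apply Rle_trans with (1 := Hp b Tb ltac:(lra)).
    apply Rmult_le_compat.
    + assert (0 <= (G + eta) * (b - t0)) by (apply Rmult_le_pos; lra). lra.
    + left; apply exp_pos.
    + apply Rplus_le_compat_l, Rmult_le_compat_l; lra.
    + apply exp_monotone, Rmult_le_compat_l; lra. }
apply le_epsilon. intros e Hepos.
set (c := (t1 - t0) * exp (L * (t1 - t0))).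
assert (Hc : 0 <= c) by (apply Rmult_le_pos; [lra|left; apply exp_pos]).
apply Rle_trans with (1 := Heta (e / (c + 1)) ltac:(apply Rdiv_lt_0_compat; lra)).
replace ((d t0 + (G + e / (c + 1)) * (t1 - t0)) * exp (L * (t1 - t0)))
  with ((d t0 + G * (t1 - t0)) * exp (L * (t1 - t0)) + e / (c + 1) * c)
  by (unfold c; ring).
apply Rplus_le_compat_l.
replace e with (e / (c + 1) * (c + 1)) at 2 by (field; lra).
apply Rmult_le_compat_l; [|lra]. left; apply Rdiv_lt_0_compat; lra.
Qed.

(** * Complex modulus and the scalar delta derivative *)

(* [Defs.C] and Coquelicot's [C] are convertible, but [ring] only knows the latter. *)
Ltac Cring :=
  change Cadd with Cplus; change Cmul with Cmult; change Csub with Cminus;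
  change Defs.C0 with (RtoC 0);
  match goal with |- ?x = ?y => change (@eq Complex.C x y); (ring || (symmetry; ring)) end.

Lemma Cmod_RtoC_minus a b : a <= b -> Cmod (RtoC b - RtoC a)%C = b - a.
Proof. intros H. rewrite <- RtoC_minus, Cmod_R, Rabs_pos_eq; lra. Qed.

Lemma Cmod_le_add z u v : z = (u + v)%C -> Cmod z <= Cmod u + Cmod v.
Proof. intros ->. apply Cmod_triangle. Qed.

Lemma Cmod_le_add3 z u v w :
  z = (u + v + w)%C -> Cmod z <= Cmod u + (Cmod v + Cmod w).
Proof.
intros ->. pose proof (Cmod_triangle (u + v) w). pose proof (Cmod_triangle u v). lra.
Qed.

Lemma Cmod_le_add4 z u v w y :
  z = (u + v + w + y)%C -> Cmod z <= Cmod u + (Cmod v + (Cmod w + Cmod y)).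
Proof.
intros ->. pose proof (Cmod_triangle (u + v + w) y).
pose proof (Cmod_le_add3 (u + v + w) u v w eq_refl). lra.
Qed.

Lemma Cmod_minus_sym u v : Cmod (u - v)%C = Cmod (v - u)%C.
Proof. rewrite <- Cmod_opp. f_equal. ring. Qed.

(** The delta derivative of one complex coordinate, so that systems can be handled
    coordinatewise. *)
Definition cderiv (T : R -> Prop) (f : R -> C) (t : R) (a : C) : Prop :=
  exists st, forward_jump T t st /\
    forall eps, 0 < eps -> exists delta, 0 < delta /\
      forall s, T s -> Rabs (t - s) < delta ->
        Cmod (f st - f s - (st - s) * a)%C <= eps * Rabs (st - s).

Lemma cderiv_right T t0 f a v : t0 <= a -> T a -> cderiv (Tfrom T t0) f a v ->
  forall eps, 0 < eps -> exists delta, 0 < delta /\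
    forall b, near T a delta b -> Cmod (f b - f a - (b - a) * v)%C <= eps * (b - a).
Proof.
intros H0 Ta [s [Hs Hd]] eps He. rewrite forward_jump_from in Hs by easy.
destruct (Hd eps He) as [d [Hd1 Hd2]].
destruct (Rle_lt_or_eq_dec _ _ (forward_jump_ge _ _ _ Hs)) as [Has| <-].
(* With this radius the only near point is the jump [s] itself, where the residual is the one tested
   at [a]. *)
- exists (s - a). split; [lra|]. intros b [Tb [Hab Hb]].
  assert (b = s) as ->.
  { destruct Hb as [Hb|Hb]; [|now apply (is_inf_unique _ _ _ Hb)].
    assert (s <= b) by now apply Hs. lra. }
  rewrite <- (Rabs_pos_eq (s - a)) by lra. apply Hd2; [split; [easy|lra]|].
  rewrite Rminus_diag, Rabs_R0. easy.
- exists d. split; [easy|]. intros b [Tb [Hab Hb]].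
  destruct Hb as [Hb|Hb]; [|pose proof (is_inf_unique _ _ _ Hb Hs); lra].
  rewrite <- Cmod_opp, <- (Rabs_pos_eq (b - a)), Rabs_minus_sym by lra.
  replace (- (f b - f a - (b - a) * v))%C with (f a - f b - (a - b) * v)%C by ring.
  apply Hd2; [split; [easy|lra]|]. rewrite Rabs_left1; lra.
Qed.

(** The value at the jump cancels between the residuals at [b] and at [a], which leaves [f a - f b]
    up to [(a - b) * v]. *)
Lemma cderiv_left_continuous T t0 f a v : t0 <= a -> T a -> cderiv (Tfrom T t0) f a v ->
  forall eps, 0 < eps -> exists delta, 0 < delta /\
    forall b, T b -> t0 <= b < a -> a - b < delta -> Cmod (f a - f b)%C <= eps.
Proof.
intros H0 Ta [s [Hs Hd]] eps He. rewrite forward_jump_from in Hs by easy.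
pose proof (forward_jump_ge _ _ _ Hs) as Has.
pose proof (Cmod_ge_0 v) as Hv.
(* Both residuals are measured from [s], which may be far from [a]; for [a - b <= 1] they add up to
   at most [e1 * (2 * (s - a) + 1)]. *)
set (e1 := eps / 2 / (2 * (s - a) + 1)).
assert (He1 : 0 < e1) by (apply Rdiv_lt_0_compat; lra).
assert (He1' : e1 * (2 * (s - a) + 1) = eps / 2) by (unfold e1; field; lra).
destruct (Hd e1 He1) as [d [Hd1 Hd2]].
set (e2 := eps / 2 / (Cmod v + 1)).
assert (He2 : 0 < e2) by (apply Rdiv_lt_0_compat; lra).
assert (He2' : e2 * (Cmod v + 1) = eps / 2) by (unfold e2; field; lra).
exists (Rmin d (Rmin 1 e2)). split; [repeat apply Rmin_pos; lra|].
intros b Tb Hb Hab.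
pose proof (Rmin_l d (Rmin 1 e2)). pose proof (Rmin_r d (Rmin 1 e2)).
pose proof (Rmin_l 1 e2). pose proof (Rmin_r 1 e2).
assert (H4 := Hd2 b ltac:(split; [easy|lra]) ltac:(rewrite Rabs_pos_eq; lra)).
assert (H5 := Hd2 a ltac:(split; [easy|lra]) ltac:(rewrite Rminus_diag, Rabs_R0; lra)).
rewrite Rabs_pos_eq in H4, H5 by lra.
apply Rle_trans with (Cmod (f s - f b - (s - b) * v)%C
  + Cmod (- (f s - f a - (s - a) * v) + (a - b) * v)%C).
{ apply Cmod_le_add. ring. }
apply Rle_trans with (e1 * (s - b) + (e1 * (s - a) + (a - b) * Cmod v)).
{ apply Rplus_le_compat; [easy|]. apply Rle_trans with (1 := Cmod_triangle _ _).
  rewrite Cmod_opp, Cmod_mult, Cmod_RtoC_minus by lra. lra. }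
assert ((a - b) * Cmod v <= e2 * (Cmod v + 1)) by (apply Rmult_le_compat; lra).
assert (e1 * (s - b) <= e1 * (s - a + 1)) by (apply Rmult_le_compat_l; lra).
lra.
Qed.

Lemma cderiv_plus T f g t a b :
  cderiv T f t a -> cderiv T g t b -> cderiv T (fun s => f s + g s)%C t (a + b)%C.
Proof.
intros [s [Hs Hf]] [s' [Hs' Hg]]. rewrite <- (is_inf_unique _ _ _ Hs Hs') in Hg.
exists s. split; [easy|]. intros eps He.
destruct (Hf (eps / 2)) as [d1 [Hd1 H1]]; [lra|].
destruct (Hg (eps / 2)) as [d2 [Hd2 H2]]; [lra|].
exists (Rmin d1 d2). split; [now apply Rmin_pos|]. intros u Tu Hu.
pose proof (Rmin_l d1 d2). pose proof (Rmin_r d1 d2).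
specialize (H1 u Tu ltac:(lra)). specialize (H2 u Tu ltac:(lra)).
eapply Rle_trans; [apply (Cmod_le_add _ (f s - f u - (s - u) * a) (g s - g u - (s - u) * b))|];
  [ring|lra].
Qed.

Lemma cderiv_scal T f t a c :
  cderiv T f t a -> cderiv T (fun s => c * f s)%C t (c * a)%C.
Proof.
intros [s [Hs Hf]]. exists s. split; [easy|]. intros eps He.
pose proof (Cmod_ge_0 c) as Hc.
destruct (Hf (eps / (Cmod c + 1))) as [d [Hd H]]; [apply Rdiv_lt_0_compat; lra|].
exists d. split; [easy|]. intros u Tu Hu. specialize (H u Tu Hu).
replace (c * f s - c * f u - (s - u) * (c * a))%C
  with (c * (f s - f u - (s - u) * a))%C by ring.
rewrite Cmod_mult.
apply Rle_trans with ((Cmod c + 1) * (eps / (Cmod c + 1) * Rabs (s - u))).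
- apply Rmult_le_compat; try apply Cmod_ge_0; lra.
- right. field. lra.
Qed.

(** The derivative of [f] supplies the forward jump at [t]; [g] does the same for the empty sum in
    [cderiv_sumC]. *)
Lemma cderiv_zero T f t a : cderiv T f t a -> cderiv T (fun _ => Defs.C0) t Defs.C0.
Proof.
intros [s [Hs _]]. exists s. split; [easy|]. intros eps He. exists 1. split; [lra|].
intros u Tu Hu. replace (_ - _ - _)%C with (RtoC 0) by (unfold Defs.C0; apply injective_projections; simpl; ring).
rewrite Cmod_0. apply Rmult_le_pos; [lra|apply Rabs_pos].
Qed.

Lemma cderiv_sumC T (f : nat -> R -> C) t a n g b :
  cderiv T g t b ->
  (forall i, (i < n)%nat -> cderiv T (f i) t (a i)) ->
  cderiv T (fun s => sumC n (fun i => f i s)) t (sumC n a).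
Proof.
intros Hg. induction n as [|n IH]; intros H; simpl.
- apply (cderiv_zero _ _ _ _ Hg).
- apply cderiv_plus; [apply IH; intros i Hi; apply H; lia|apply H; lia].
Qed.

(** * Euler polygons for the scalar equation *)

(* The error is relative to [x a], so no a priori bound on [x] is needed to choose
   the step size in [approx_extend]. *)
Definition approx (T : R -> Prop) (lam : C) (t0 e t1 : R) (x : R -> C) : Prop :=
  x t0 = RtoC 1 /\
  (forall a, T a -> t0 <= a < t1 -> exists delta, 0 < delta /\
     forall b, near T a delta b -> b <= t1 ->
       Cmod (x b - x a - lam * (b - a) * x a)%C <= e * (b - a) * Cmod (x a)) /\
  (forall a, T a -> t0 < a <= t1 -> forall eta, 0 < eta -> exists delta, 0 < delta /\
     forall b, T b -> t0 <= b < a -> a - b < delta -> Cmod (x a - x b)%C <= eta).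

Lemma approx_restrict T lam t0 e t1 t2 x :
  t2 <= t1 -> approx T lam t0 e t1 x -> approx T lam t0 e t2 x.
Proof.
intros H [H1 [H2 H3]]. split; [easy|]. split.
- intros a Ta Ha. destruct (H2 a Ta ltac:(lra)) as [d [Hd Hb]].
  exists d. split; [easy|]. intros b Hn Hb2. apply Hb; [easy|lra].
- intros a Ta Ha. apply H3; [easy|lra].
Qed.

(** Continue [x] affinely with slope [lam * x s]. Inside a short cell the slope is off by
    [lam * lam * (a - s) * x s], while the factor [1 + lam * (a - s)] has modulus at least 1/2, so
    the relative error is at most [2 * Cmod lam * Cmod lam * h]. *)
Lemma approx_extend T lam t0 e h s s' x :
  0 <= h -> Cmod lam * h <= / 2 -> 2 * Cmod lam * Cmod lam * h <= e ->
  T s -> T s' -> t0 <= s < s' -> s' - s <= h \/ forward_jump T s s' ->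
  approx T lam t0 e s x -> exists y, approx T lam t0 e s' y.
Proof.
intros Hh Hh1 Hh2 Ts Ts' Hss Hcell [H1 [H2 H3]].
pose proof (Cmod_ge_0 lam) as Hlam.
set (y := fun t => if Rle_dec t s then x t else (x s * (1 + lam * (t - s)))%C).
assert (Hy1 : forall t, t <= s -> y t = x t).
{ intros t Ht. unfold y. destruct (Rle_dec t s); [easy|lra]. }
assert (Hy2 : forall t, s <= t -> y t = (x s * (1 + lam * (t - s)))%C).
{ intros t Ht. unfold y. destruct (Rle_dec t s); [|easy].
  replace t with s by lra. ring. }
exists y. split; [rewrite Hy1; [easy|lra]|]. split.
- intros a Ta Ha. destruct (Rlt_dec a s) as [Has|Has].
  + destruct (H2 a Ta ltac:(lra)) as [d [Hd Hb]].
    exists (Rmin d (s - a)). split; [apply Rmin_pos; lra|].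
    pose proof (Rmin_l d (s - a)). pose proof (Rmin_r d (s - a)).
    intros b [Tb [Hab Hn]] Hbs'.
    assert (b <= s).
    (* A jump from [a < s] cannot pass over [s], which belongs to [T]. *)
    { destruct Hn as [Hn|Hn]; [lra|]. apply Hn. split; [easy|lra]. }
    rewrite !Hy1 by lra. apply Hb; [|easy].
    split; [easy|]. split; [easy|]. destruct Hn; [left; lra|now right].
  + exists 1. split; [lra|]. intros b [Tb [Hab Hn]] Hbs'.
    rewrite (Hy2 b), (Hy2 a) by lra.
    replace (x s * (1 + lam * (b - s)) - x s * (1 + lam * (a - s)) -
      lam * (b - a) * (x s * (1 + lam * (a - s))))%C
      with (- ((b - a) * (lam * lam * (a - s) * x s)))%C by ring.
    rewrite Cmod_opp, !Cmod_mult, !Cmod_RtoC_minus by lra.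
    set (q := Cmod (1 + lam * (a - s))%C). pose proof (Cmod_ge_0 (x s)) as Hx.
    assert (Hq0 : 0 <= q) by apply Cmod_ge_0.
    assert (He : 0 <= e).
    { apply Rle_trans with (2 := Hh2). repeat apply Rmult_le_pos; lra. }
    assert (Hq : Cmod lam * Cmod lam * (a - s) <= e * q).
    (* At the left end of the cell the Euler step is exact. This is the only case for a jump cell,
       which has no interior points in [T]. *)
    { destruct (Req_dec a s) as [->|Hne]; [rewrite Rminus_diag, Rmult_0_r; now apply Rmult_le_pos|].
      destruct Hcell as [Hc|Hc].
      2:{ assert (s' <= a) by (apply Hc; split; [easy|lra]). lra. }
      assert (/ 2 <= q).
      { assert (1 <= q + Cmod lam * (a - s)).
        { rewrite <- (Cmod_RtoC_minus s a), <- Cmod_mult by lra. rewrite <- (Cmod_opp (lam * _)%C).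
          rewrite <- Cmod_1 at 1. apply Cmod_le_add. ring. }
        assert (Cmod lam * (a - s) <= Cmod lam * h) by (apply Rmult_le_compat_l; lra). lra. }
      assert (Cmod lam * Cmod lam * (a - s) <= Cmod lam * Cmod lam * h).
      { apply Rmult_le_compat_l; [now apply Rmult_le_pos|lra]. }
      assert (e * / 2 <= e * q) by (apply Rmult_le_compat_l; lra). lra. }
    replace (e * (b - a) * (Cmod (x s) * q)) with ((b - a) * (e * q * Cmod (x s))) by ring.
    apply Rmult_le_compat_l; [lra|]. now apply Rmult_le_compat_r.
- intros a Ta Ha eta Heta. destruct (Rle_dec a s) as [Has|Has].
  + destruct (H3 a Ta ltac:(lra) eta Heta) as [d [Hd Hb]].
    exists d. split; [easy|]. intros b Tb Hb1 Hb2. rewrite !Hy1 by lra. now apply Hb.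
  + set (c := Cmod (x s * lam)%C). assert (Hc : 0 <= c) by apply Cmod_ge_0.
    exists (Rmin (a - s) (eta / (c + 1))).
    split; [apply Rmin_pos; [lra|apply Rdiv_lt_0_compat; lra]|].
    intros b Tb Hb1 Hb2.
    pose proof (Rmin_l (a - s) (eta / (c + 1))). pose proof (Rmin_r (a - s) (eta / (c + 1))).
    rewrite !Hy2 by lra.
    replace (x s * (1 + lam * (a - s)) - x s * (1 + lam * (b - s)))%C
      with (x s * lam * (a - b))%C by ring.
    rewrite Cmod_mult, Cmod_RtoC_minus by lra. fold c.
    replace eta with ((c + 1) * (eta / (c + 1))) by (field; lra).
    apply Rmult_le_compat; lra.
Qed.

Lemma approx_exists T lam t0 e t1 : closedT T -> T t0 -> T t1 -> t0 <= t1 -> 0 < e ->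
  exists x, approx T lam t0 e t1 x.
Proof.
intros HT T0 T1 H01 He.
set (L := Cmod lam). assert (HL : 0 <= L) by apply Cmod_ge_0.
assert (exists h, 0 < h /\ L * h <= / 2 /\ 2 * L * L * h <= e) as [h [Hh [Hh1 Hh2]]].
{ exists (Rmin (/ 2 / (L + 1)) (e / (2 * L * L + 1))).
  assert (0 <= 2 * L * L) by nra.
  set (h1 := / 2 / (L + 1)). set (h2 := e / (2 * L * L + 1)).
  assert (0 < h1) by (apply Rdiv_lt_0_compat; lra).
  assert (0 < h2) by (apply Rdiv_lt_0_compat; lra).
  split; [now apply Rmin_pos|].
  pose proof (Rmin_l h1 h2). pose proof (Rmin_r h1 h2).
  assert (0 < Rmin h1 h2) by now apply Rmin_pos.
  split.
  - replace (/ 2) with ((L + 1) * h1) by (unfold h1; field; lra).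
    apply Rmult_le_compat; lra.
  - replace e with ((2 * L * L + 1) * h2) by (unfold h2; field; lra).
    apply Rmult_le_compat; lra. }
apply (ts_induction T t0 t1 (fun t => exists x, approx T lam t0 e t x)); try easy.
- exists (fun _ => RtoC 1). split; [easy|]. split; intros a Ta Ha; lra.
- intros a Ta Ha [x Hx]. exists h. split; [easy|]. intros b [Tb [Hab Hb]] Hb1.
  apply (approx_extend T lam t0 e h a b x); try easy; try lra.
  destruct Hb; [left; lra|now right].
- intros a Ta Ha Hden Hp. destruct (Hden h Hh) as [b [Tb [H0b Hb]]].
  destruct (Hp b Tb ltac:(lra)) as [x Hx].
  apply (approx_extend T lam t0 e h b a x); try easy; lra.
Qed.

(** Gronwall without forcing: a relative error only raises the growth rate from [Cmod lam] to
    [Cmod lam + e]. *)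
Lemma approx_bound T lam t0 e t1 x : closedT T -> T t0 -> T t1 -> t0 <= t1 -> 0 <= e ->
  approx T lam t0 e t1 x -> Cmod (x t1) <= exp ((Cmod lam + e) * (t1 - t0)).
Proof.
intros HT T0 T1 H01 He [H1 [H2 H3]].
pose proof (Cmod_ge_0 lam) as Hlam.
replace (exp _) with ((Cmod (x t0) + 0 * (t1 - t0)) * exp ((Cmod lam + e) * (t1 - t0))).
2:{ rewrite H1, Cmod_1. ring. }
apply (gronwall T t0 t1 (fun t => Cmod (x t))); try easy; try lra.
- apply Cmod_ge_0.
- intros a Ta Ha eta Heta. destruct (H2 a Ta Ha) as [d [Hd Hb]].
  exists d. split; [easy|]. intros b Hn Hb1. specialize (Hb b Hn Hb1).
  destruct Hn as [_ [Hab _]].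
  apply Rle_trans with (Cmod (x b - x a - lam * (b - a) * x a)%C + Cmod (x a + lam * (b - a) * x a)%C).
  { apply Cmod_le_add. ring. }
  assert (Cmod (x a + lam * (b - a) * x a)%C <= Cmod (x a) + Cmod lam * (b - a) * Cmod (x a)).
  { rewrite <- (Cmod_RtoC_minus a b), <- !Cmod_mult by lra. now apply Cmod_le_add. }
  nra.
- intros a Ta Ha eta Heta. destruct (H3 a Ta Ha eta Heta) as [d [Hd Hb]].
  exists d. split; [easy|]. intros b Tb Hb1 Hb2. specialize (Hb b Tb Hb1 Hb2).
  apply Rle_trans with (Cmod (x b) + Cmod (x a - x b)%C); [|lra]. apply Cmod_le_add. ring.
Qed.

Lemma approx_bound_before T lam t0 e t1 x a :
  closedT T -> T t0 -> T a -> t0 <= a <= t1 -> 0 <= e <= 1 ->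
  approx T lam t0 e t1 x -> Cmod (x a) <= exp ((Cmod lam + 1) * (t1 - t0)).
Proof.
intros HT T0 Ta Ha He Hx. pose proof (Cmod_ge_0 lam) as Hlam.
apply Rle_trans with (exp ((Cmod lam + e) * (a - t0))).
- apply (approx_bound T); try easy. apply approx_restrict with t1; easy.
- apply exp_monotone, Rmult_le_compat; lra.
Qed.

(** The difference of two polygons starts at 0 and is forced by the two step errors, which the a
    priori bound [E] makes absolute. This is the Cauchy estimate for the limit in [e]. *)
Lemma approx_compare T lam t0 e e' t1 x y :
  closedT T -> T t0 -> T t1 -> t0 <= t1 -> 0 <= e <= 1 -> 0 <= e' <= 1 ->
  approx T lam t0 e t1 x -> approx T lam t0 e' t1 y ->
  Cmod (x t1 - y t1)%C <= (e + e') *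
    (exp ((Cmod lam + 1) * (t1 - t0)) * (t1 - t0) * exp (Cmod lam * (t1 - t0))).
Proof.
intros HT T0 T1 H01 He He' Hx Hy. pose proof (Cmod_ge_0 lam) as Hlam.
set (E := exp ((Cmod lam + 1) * (t1 - t0))). assert (HE : 0 < E) by apply exp_pos.
assert (H0 : Cmod (x t0 - y t0)%C = 0).
{ destruct Hx as [-> _], Hy as [-> _]. rewrite <- Cmod_0. f_equal. ring. }
replace ((e + e') * (E * (t1 - t0) * exp (Cmod lam * (t1 - t0))))
  with ((Cmod (x t0 - y t0)%C + (e + e') * E * (t1 - t0)) * exp (Cmod lam * (t1 - t0)))
  by (rewrite H0; ring).
apply (gronwall T t0 t1 (fun t => Cmod (x t - y t)%C)); try easy.
- apply Rmult_le_pos; lra.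
- apply Cmod_ge_0.
- intros a Ta Ha eta Heta.
  assert (Bx := approx_bound_before T lam t0 e t1 x a HT T0 Ta ltac:(lra) He Hx).
  assert (By := approx_bound_before T lam t0 e' t1 y a HT T0 Ta ltac:(lra) He' Hy).
  fold E in Bx, By.
  destruct Hx as [_ [Hx _]], Hy as [_ [Hy _]].
  destruct (Hx a Ta Ha) as [d1 [Hd1 H1]]. destruct (Hy a Ta Ha) as [d2 [Hd2 H2]].
  exists (Rmin d1 d2). split; [now apply Rmin_pos|].
  pose proof (Rmin_l d1 d2). pose proof (Rmin_r d1 d2).
  intros b [Tb [Hab Hn]] Hb1.
  assert (N1 : near T a d1 b) by (repeat split; try easy; destruct Hn; [left; lra|now right]).
  assert (N2 : near T a d2 b) by (repeat split; try easy; destruct Hn; [left; lra|now right]).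
  specialize (H1 b N1 Hb1). specialize (H2 b N2 Hb1).
  apply Rle_trans with
    (Cmod (x a - y a)%C + (Cmod (lam * (b - a) * (x a - y a))%C +
      (Cmod (x b - x a - lam * (b - a) * x a)%C + Cmod (- (y b - y a - lam * (b - a) * y a))%C))).
  { apply Cmod_le_add4. ring. }
  rewrite Cmod_opp, !Cmod_mult, Cmod_RtoC_minus by lra.
  assert (e * (b - a) * Cmod (x a) <= e * (b - a) * E)
    by (apply Rmult_le_compat_l; [apply Rmult_le_pos; lra|easy]).
  assert (e' * (b - a) * Cmod (y a) <= e' * (b - a) * E)
    by (apply Rmult_le_compat_l; [apply Rmult_le_pos; lra|easy]).
  assert (0 <= (b - a) * eta) by (apply Rmult_le_pos; lra).
  lra.
- intros a Ta Ha eta Heta.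
  destruct Hx as [_ [_ Hx]], Hy as [_ [_ Hy]].
  destruct (Hx a Ta Ha (eta / 2)) as [d1 [Hd1 H1]]; [lra|].
  destruct (Hy a Ta Ha (eta / 2)) as [d2 [Hd2 H2]]; [lra|].
  exists (Rmin d1 d2). split; [now apply Rmin_pos|].
  pose proof (Rmin_l d1 d2). pose proof (Rmin_r d1 d2).
  intros b Tb Hb1 Hb2.
  specialize (H1 b Tb Hb1 ltac:(lra)). specialize (H2 b Tb Hb1 ltac:(lra)).
  apply Rle_trans with (Cmod (x b - y b)%C + (Cmod (x a - x b)%C + Cmod (- (y a - y b))%C)).
  { apply Cmod_le_add3. ring. }
  rewrite Cmod_opp. lra.
Qed.

(* Second-order Taylor estimate; unlike the derivative at a single point it
   survives the passage to the limit in [e]. *)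
Lemma approx_taylor T lam t0 e t1 x a b :
  closedT T -> T t0 -> T a -> T b -> t0 <= a <= b -> b <= t1 -> 0 <= e <= 1 ->
  approx T lam t0 e t1 x ->
  let E := exp ((Cmod lam + 1) * (t1 - t0)) in
  Cmod (x b - x a - lam * (b - a) * x a)%C <=
    (Cmod lam * Cmod lam * (b - a) + e) * E * (b - a) * exp (Cmod lam * (b - a)).
Proof.
intros HT T0 Ta Tb Hab Hb1 He Hx E. pose proof (Cmod_ge_0 lam) as Hlam.
assert (HE : 0 < E) by apply exp_pos.
assert (Bd : forall c, T c -> a <= c <= b -> Cmod (x c) <= E).
{ intros c Tc Hc. apply (approx_bound_before T lam t0 e t1 x); try easy. lra. }
destruct Hx as [_ [H2 H3]].
set (d := fun t => Cmod (x t - x a - lam * (t - a) * x a)%C).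
assert (Hd0 : d a = 0).
{ unfold d. rewrite <- Cmod_0. f_equal. ring. }
replace ((Cmod lam * Cmod lam * (b - a) + e) * E * (b - a) * exp (Cmod lam * (b - a)))
 with ((d a + (Cmod lam * Cmod lam * (b - a) + e) * E * (b - a)) * exp (Cmod lam * (b - a)))
 by (rewrite Hd0; ring).
assert (HLL : 0 <= Cmod lam * Cmod lam) by now apply Rmult_le_pos.
apply (gronwall T a b d); try easy.
- apply Rmult_le_pos; [|lra].
  assert (0 <= Cmod lam * Cmod lam * (b - a)) by (apply Rmult_le_pos; lra). lra.
- lra.
- intros c Tc Hc eta Heta. destruct (H2 c Tc ltac:(lra)) as [del [Hdel Hst]].
  exists del. split; [easy|]. intros f Hn Hfb. specialize (Hst f Hn ltac:(lra)).
  destruct Hn as [Tf [Hcf _]].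
  assert (Bc := Bd c Tc ltac:(lra)). assert (Ba := Bd a Ta ltac:(lra)).
  unfold d at 1.
  (* Split the increment of the remainder into the step error, [lam] times the remainder at [c] (the
     Gronwall rate), and [lam] times the linear term (a source of size [b - a]). *)
  apply Rle_trans with (d c + (Cmod (x f - x c - lam * (f - c) * x c)%C +
    (Cmod (lam * (f - c) * (x c - x a - lam * (c - a) * x a))%C +
     Cmod (lam * (f - c) * (lam * (c - a) * x a))%C))).
  { unfold d. apply Cmod_le_add4. ring. }
  rewrite !Cmod_mult, !Cmod_RtoC_minus by lra. fold (d c).
  assert (e * (f - c) * Cmod (x c) <= e * (f - c) * E)
    by (apply Rmult_le_compat_l; [apply Rmult_le_pos; lra|easy]).
  assert (Cmod lam * Cmod lam * ((c - a) * Cmod (x a)) <= Cmod lam * Cmod lam * ((b - a) * E)).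
  { apply Rmult_le_compat_l; [easy|]. apply Rmult_le_compat; try lra. apply Cmod_ge_0. }
  assert ((f - c) * (Cmod lam * Cmod lam * ((c - a) * Cmod (x a))) <=
          (f - c) * (Cmod lam * Cmod lam * ((b - a) * E))) by (apply Rmult_le_compat_l; lra).
  assert (0 <= (f - c) * eta) by (apply Rmult_le_pos; lra).
  lra.
- intros c Tc Hc eta Heta.
  set (k := Cmod (lam * x a)%C). assert (Hk : 0 <= k) by apply Cmod_ge_0.
  destruct (H3 c Tc ltac:(lra) (eta / 2)) as [del [Hdel Hst]]; [lra|].
  set (m := eta / 2 / (k + 1)).
  assert (Hm : 0 < m) by (apply Rdiv_lt_0_compat; lra).
  exists (Rmin del m). split; [now apply Rmin_pos|].
  pose proof (Rmin_l del m). pose proof (Rmin_r del m).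
  intros f Tf Hf Hfc. specialize (Hst f Tf ltac:(lra) ltac:(lra)).
  unfold d.
  apply Rle_trans with (Cmod (x f - x a - lam * (f - a) * x a)%C +
    (Cmod (x c - x f)%C + Cmod (- (lam * x a * (c - f)))%C)).
  { apply Cmod_le_add3. ring. }
  rewrite Cmod_opp, (Cmod_mult (lam * x a)%C), Cmod_RtoC_minus by lra. fold k.
  assert (k * (c - f) <= (k + 1) * m) by (apply Rmult_le_compat; lra).
  replace ((k + 1) * m) with (eta / 2) in H1 by (unfold m; field; lra).
  lra.
Qed.

(** * Passage to the limit and solutions of the scalar equation *)

Definition Clim (u : nat -> C) (l : C) : Prop :=
  forall eta, 0 < eta -> exists N, forall k, (N <= k)%nat -> Cmod (u k - l)%C <= eta.

Lemma im_le_Cmod z : Rabs (snd z) <= Cmod z.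
Proof. apply Rle_trans with (2 := Rmax_Cmod z), Rmax_r. Qed.

Lemma Clim_exists (u : nat -> C) :
  (forall eta, 0 < eta -> exists N, forall k m, (N <= k)%nat -> (N <= m)%nat ->
     Cmod (u k - u m)%C <= eta) ->
  exists l, Clim u l.
Proof.
intros H.
assert (Hc : forall p : C -> R, (forall z w, p (z - w)%C = p z - p w) ->
  (forall z, Rabs (p z) <= Cmod z) -> Cauchy_crit (fun k => p (u k))).
{ intros p Hp1 Hp2 eps He. destruct (H (eps / 2)) as [N HN]; [lra|]. exists N.
  intros k m Hk Hm. unfold Rdist. rewrite <- Hp1.
  apply Rle_lt_trans with (1 := Hp2 _). apply Rle_lt_trans with (1 := HN k m Hk Hm). lra. }
destruct (R_complete _ (Hc fst (fun _ _ => eq_refl) re_le_Cmod)) as [l1 H1].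
destruct (R_complete _ (Hc snd (fun _ _ => eq_refl) im_le_Cmod)) as [l2 H2].
exists (l1, l2). intros eta He.
destruct (H1 (eta / 2)) as [N1 HN1]; [lra|]. destruct (H2 (eta / 2)) as [N2 HN2]; [lra|].
exists (max N1 N2). intros k Hk.
specialize (HN1 k ltac:(lia)). specialize (HN2 k ltac:(lia)). unfold Rdist in *.
apply Rle_trans with (Cmod (RtoC (fst (u k) - l1)) + Cmod (Ci * RtoC (snd (u k) - l2))%C).
- apply Cmod_le_add. destruct (u k) as [p q].
  unfold Cminus, Cplus, Cmult, Copp, RtoC, Ci; simpl. f_equal; ring.
- rewrite Cmod_mult, !Cmod_R. replace (Cmod Ci) with 1; [lra|].
  unfold Cmod, Ci; simpl. symmetry. transitivity (sqrt 1); [f_equal; ring|apply sqrt_1].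
Qed.

Lemma Clim_step_bound (u v : nat -> C) lu lv c B :
  Clim u lu -> Clim v lv ->
  (forall eta, 0 < eta -> exists N, forall k, (N <= k)%nat ->
     Cmod (v k - u k - c * u k)%C <= B + eta) ->
  Cmod (lv - lu - c * lu)%C <= B.
Proof.
intros Hu Hv H. apply le_epsilon. intros e He.
pose proof (Cmod_ge_0 c) as Hc.
set (m := e / 3 / (1 + Cmod c)).
assert (Hm : 0 < m) by (apply Rdiv_lt_0_compat; lra).
destruct (H (e / 3)) as [N1 H1]; [lra|]. destruct (Hv (e / 3)) as [N2 H2]; [lra|].
destruct (Hu m Hm) as [N3 H3].
set (k := max N1 (max N2 N3)).
specialize (H1 k ltac:(lia)). specialize (H2 k ltac:(lia)). specialize (H3 k ltac:(lia)).
apply Rle_trans with (Cmod (v k - u k - c * u k)%C + (Cmod (- (v k - lv))%C +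
  Cmod ((1 + c) * (u k - lu))%C)).
{ apply Cmod_le_add3. ring. }
rewrite Cmod_opp, Cmod_mult.
assert (Cmod (1 + c)%C <= 1 + Cmod c).
{ rewrite <- Cmod_1 at 2. apply Cmod_triangle. }
assert (Cmod (1 + c)%C * Cmod (u k - lu)%C <= (1 + Cmod c) * m).
{ apply Rmult_le_compat; try easy; apply Cmod_ge_0. }
replace ((1 + Cmod c) * m) with (e / 3) in H4 by (unfold m; field; lra).
lra.
Qed.

(** The second bound ensures that the [k]-th polygon, which runs up to [t0 + INR k], reaches the
    time considered. *)
Lemma inv_INR_small c eta m : 0 <= c -> 0 < eta ->
  exists N, forall k, (N <= k)%nat -> / (INR k + 1) * c <= eta /\ m <= INR k.
Proof.
intros Hc He. destruct (INR_unbounded (Rmax m (c / eta))) as [N HN].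
exists N. intros k Hk. apply le_INR in Hk.
pose proof (Rmax_l m (c / eta)). pose proof (Rmax_r m (c / eta)).
assert (0 <= INR k) by apply pos_INR.
split; [|lra].
apply Rmult_le_reg_l with (INR k + 1); [lra|].
replace ((INR k + 1) * (/ (INR k + 1) * c)) with c by (field; lra).
apply Rle_trans with (c / eta * eta); [right; field; lra|].
apply Rmult_le_compat_r; lra.
Qed.

(** Polygons of tolerance [/ (INR k + 1)] converge at each time. A quadratic remainder is useless
    across a jump of fixed size, so the exact recursion there is recorded separately; together the
    two properties yield the delta derivative. *)
Lemma scalar_solution_taylor T lam t0 : closedT T -> sup_infinite T -> T t0 ->
  exists x : R -> C, x t0 = RtoC 1 /\
    (forall a s, T a -> t0 <= a < s -> forward_jump T a s ->
       x s = x a + lam * (s - a) * x a)%C /\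
    (forall t1, t0 <= t1 -> exists K, 0 <= K /\
       forall a b, T a -> T b -> t0 <= a <= b -> b <= t1 ->
       Cmod (x b - x a - lam * (b - a) * x a)%C <= K * (b - a) * (b - a)).
Proof.
intros HT Hsup T0. pose proof (Cmod_ge_0 lam) as Hlam.
destruct (choice (fun (k : nat) (x : R -> C) =>
  approx T lam t0 (/ (INR k + 1)) (t0 + INR k) x)) as [X HX].
{ intros k. destruct (Hsup (t0 + INR k)) as [t1 [Tt1 Ht1]].
  assert (0 <= INR k) by apply pos_INR.
  destruct (approx_exists T lam t0 (/ (INR k + 1)) t1) as [x Hx]; try easy; try lra.
  { apply Rinv_0_lt_compat; lra. }
  exists x. apply approx_restrict with t1; [lra|easy]. }
assert (He : forall k, 0 <= / (INR k + 1) <= 1).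
{ intros k. assert (0 <= INR k) by apply pos_INR. split.
  - left; apply Rinv_0_lt_compat; lra.
  - rewrite <- Rinv_1. apply Rinv_le_contravar; lra. }
(* Pointwise limits, with default value 0 off [T] and before [t0]. *)
destruct (choice (fun t l => T t /\ t0 <= t -> Clim (fun k => X k t) l)) as [x Hx].
{ intros t. destruct (classic (T t /\ t0 <= t)) as [[Tt Ht]|Hn];
    [|exists (RtoC 0); tauto].
  destruct (Clim_exists (fun k => X k t)) as [l Hl]; [|now exists l].
  intros eta Heta.
  set (c := exp ((Cmod lam + 1) * (t - t0)) * (t - t0) * exp (Cmod lam * (t - t0))).
  assert (Hc : 0 <= c).
  { pose proof (exp_pos ((Cmod lam + 1) * (t - t0))). pose proof (exp_pos (Cmod lam * (t - t0))).
    repeat apply Rmult_le_pos; lra. }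
  destruct (inv_INR_small c (eta / 2) (t - t0) Hc ltac:(lra)) as [N HN].
  exists N. intros k m Hk Hm.
  destruct (HN k Hk) as [Hk1 Hk2]. destruct (HN m Hm) as [Hm1 Hm2].
  apply Rle_trans with ((/ (INR k + 1) + / (INR m + 1)) * c); [|lra].
  apply (approx_compare T); try easy; [apply approx_restrict with (2 := HX k); lra|
    apply approx_restrict with (2 := HX m); lra]. }
exists x. split; [|split].
- assert (H : Cmod (x t0 - RtoC 1)%C = 0).
  { apply Rle_antisym; [|apply Cmod_ge_0]. apply le_epsilon. intros e Hepos.
    destruct (Hx t0 ltac:(split; [easy|lra]) e Hepos) as [N HN].
    specialize (HN N (le_n N)). rewrite (proj1 (HX N)), Cmod_minus_sym in HN. lra. }
  apply Cmod_eq_0 in H. replace (x t0) with (x t0 - 1 + 1)%C by ring. rewrite H. ring.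
- intros a s Ta Has Hs.
  assert (Ts := forward_jump_closed _ _ _ HT Ta Hs).
  assert (H : Cmod (x s - x a - lam * (s - a) * x a)%C = 0).
  { apply Rle_antisym; [|apply Cmod_ge_0].
    apply (Clim_step_bound (fun k => X k a) (fun k => X k s)); [apply Hx|apply Hx|];
      try (split; [easy|lra]).
    intros eta Heta.
    set (E := exp ((Cmod lam + 1) * (s - t0))).
    assert (HE : 0 < E) by apply exp_pos.
    destruct (inv_INR_small ((s - a) * E) eta (s - t0)) as [N HN]; [apply Rmult_le_pos; lra|easy|].
    exists N. intros k Hk. destruct (HN k Hk) as [Hk1 Hk2].
    assert (Ha : approx T lam t0 (/ (INR k + 1)) s (X k)).
    { apply approx_restrict with (2 := HX k). lra. }
    assert (HB := approx_bound_before T lam t0 _ s (X k) a HT T0 Ta ltac:(lra) (He k) Ha).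
    destruct Ha as [_ [Ha _]]. destruct (Ha a Ta ltac:(lra)) as [d [Hd Hb]].
    (* A jump counts as one near step whatever its length, so its error vanishes as [k] grows. *)
    specialize (Hb s ltac:(split; [easy|split; [lra|now right]]) ltac:(lra)).
    apply Rle_trans with (1 := Hb). rewrite Rplus_0_l. apply Rle_trans with (2 := Hk1).
    rewrite Rmult_assoc. apply Rmult_le_compat_l; [apply He|].
    apply Rmult_le_compat_l; [lra|easy]. }
  apply Cmod_eq_0 in H.
  replace (x s) with (x s - x a - lam * (s - a) * x a + (x a + lam * (s - a) * x a))%C by ring.
  rewrite H. ring.
- intros t1 Ht1.
  set (E := exp ((Cmod lam + 1) * (t1 - t0))). assert (HE : 0 < E) by apply exp_pos.
  set (F := exp (Cmod lam * (t1 - t0))). assert (HF : 0 < F) by apply exp_pos.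
  set (K := Cmod lam * Cmod lam * E * F).
  assert (HLL : 0 <= Cmod lam * Cmod lam) by now apply Rmult_le_pos.
  assert (HK : 0 <= K) by (unfold K; repeat apply Rmult_le_pos; lra).
  exists K. split; [easy|]. intros a b Ta Tb Hab Hb1.
  apply (Clim_step_bound (fun k => X k a) (fun k => X k b)).
  + apply Hx. split; [easy|lra].
  + apply Hx. split; [easy|lra].
  + intros eta Heta.
    destruct (inv_INR_small (E * (b - a) * F) eta (t1 - t0)) as [N HN];
      [repeat apply Rmult_le_pos; lra|easy|].
    exists N. intros k Hk. destruct (HN k Hk) as [Hk1 Hk2].
    assert (Ha : approx T lam t0 (/ (INR k + 1)) t1 (X k)).
    { apply approx_restrict with (2 := HX k). lra. }
    apply Rle_trans with (1 := approx_taylor T lam t0 _ t1 (X k) a b HT T0 Ta Tb Hab Hb1 (He k) Ha).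
    fold E.
    apply Rle_trans with ((Cmod lam * Cmod lam * (b - a) + / (INR k + 1)) * E * (b - a) * F).
    * apply Rmult_le_compat_l.
      { pose proof (proj1 (He k)).
        assert (0 <= Cmod lam * Cmod lam * (b - a)) by (apply Rmult_le_pos; lra).
        repeat apply Rmult_le_pos; lra. }
      apply exp_monotone, Rmult_le_compat_l; lra.
    * unfold K. lra.
Qed.

Lemma scalar_solution_exists T lam t0 : closedT T -> sup_infinite T -> T t0 ->
  exists x : R -> C, x t0 = RtoC 1 /\
    forall t, T t -> t0 <= t -> cderiv (Tfrom T t0) x t (lam * x t)%C.
Proof.
intros HT Hsup T0. pose proof (Cmod_ge_0 lam) as Hlam.
destruct (scalar_solution_taylor T lam t0 HT Hsup T0) as [x [H1 [H2 H3]]].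
exists x. split; [easy|]. intros t Tt Ht.
destruct (forward_jump_exists T t Hsup) as [s Hs].
exists s. split; [now apply forward_jump_from|]. intros eps He.
destruct (H3 (t + 1) ltac:(lra)) as [K [HK HT3]].
pose proof (Cmod_ge_0 (x t)) as Hxt.
set (Q := K + Cmod lam * Cmod (x t)).
assert (HQ : 0 <= Q) by (unfold Q; assert (0 <= Cmod lam * Cmod (x t)) by (now apply Rmult_le_pos); lra).
(* For points before [t] the Taylor estimate is centred at [u], whereas the derivative involves
   [lam * x t]; exchanging [x u] for [x t] costs another quadratic term. *)
assert (Hback : forall u, T u -> t0 <= u <= t -> t - u <= 1 -> Cmod lam * (t - u) <= / 2 ->
   Cmod (x t - x u - (t - u) * (lam * x t))%C <=
     (K + 2 * (Cmod lam * (K + Cmod lam * Cmod (x t)))) * (t - u) * (t - u)).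
{ intros u Tu Hu Hu1 Hu2.
  assert (HB := HT3 u t Tu Tt ltac:(lra) ltac:(lra)).
  set (D := Cmod (x t - x u)%C).
  (* [D] occurs on the right with a factor at most 1/2 and is absorbed, which gives a bound linear
     in [t - u]. *)
  assert (HD : D <= K * (t - u) * (t - u) + Cmod lam * (t - u) * (D + Cmod (x t))).
  { unfold D at 1. eapply Rle_trans; [apply (Cmod_le_add _ (x t - x u - lam * (t - u) * x u)
      (lam * (t - u) * x u)); ring|].
    rewrite (Cmod_mult (lam * (t - u))%C), (Cmod_mult lam), Cmod_RtoC_minus by lra.
    apply Rplus_le_compat; [easy|]. apply Rmult_le_compat_l; [apply Rmult_le_pos; lra|].
    unfold D. rewrite Cmod_minus_sym. apply Cmod_le_add. ring. }
  assert (HD0 : 0 <= D) by apply Cmod_ge_0.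
  assert (Cmod lam * (t - u) * D <= / 2 * D) by (now apply Rmult_le_compat_r).
  assert (K * (t - u) * (t - u) <= K * (t - u) * 1).
  { apply Rmult_le_compat_l; [apply Rmult_le_pos; lra|easy]. }
  assert (HD2 : D <= 2 * ((K + Cmod lam * Cmod (x t)) * (t - u))) by lra.
  eapply Rle_trans; [apply (Cmod_le_add _ (x t - x u - lam * (t - u) * x u)
    (- (lam * (t - u) * (x t - x u)))); ring|].
  rewrite Cmod_opp, (Cmod_mult (lam * (t - u))%C), (Cmod_mult lam), Cmod_RtoC_minus by lra.
  fold D.
  assert (Cmod lam * (t - u) * D <= Cmod lam * (t - u) * (2 * ((K + Cmod lam * Cmod (x t)) * (t - u)))).
  { apply Rmult_le_compat_l; [apply Rmult_le_pos; lra|easy]. }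
  lra. }
fold Q in Hback.
set (P := K + 2 * (Cmod lam * Q)) in *.
assert (HP : K <= P) by (unfold P; assert (0 <= Cmod lam * Q) by (now apply Rmult_le_pos); lra).
set (d1 := eps / (P + 1)). assert (Hd1 : 0 < d1) by (apply Rdiv_lt_0_compat; lra).
assert (Hd1e : P * d1 <= eps).
{ replace eps with ((P + 1) * d1) by (unfold d1; field; lra). apply Rmult_le_compat_r; lra. }
set (d2 := / 2 / (Cmod lam + 1)). assert (Hd2 : 0 < d2) by (apply Rdiv_lt_0_compat; lra).
assert (Hd2e : Cmod lam * d2 <= / 2).
{ replace (/ 2) with ((Cmod lam + 1) * d2) by (unfold d2; field; lra). apply Rmult_le_compat_r; lra. }
set (d := Rmin 1 (Rmin d1 d2)).
assert (Hd : 0 < d) by (repeat apply Rmin_pos; lra).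
assert (Hdle : d <= 1 /\ d <= d1 /\ d <= d2).
{ unfold d. pose proof (Rmin_l 1 (Rmin d1 d2)). pose proof (Rmin_r 1 (Rmin d1 d2)).
  pose proof (Rmin_l d1 d2). pose proof (Rmin_r d1 d2). lra. }
assert (Hquad : forall r, 0 <= r < d -> P * r * r <= eps * r).
{ intros r Hr. apply Rmult_le_compat_r; [lra|].
  apply Rle_trans with (2 := Hd1e). apply Rmult_le_compat_l; lra. }
assert (Hb2 : forall u, T u -> t0 <= u <= t -> t - u < d ->
   Cmod (x t - x u - (t - u) * (lam * x t))%C <= eps * (t - u)).
{ intros u Tu Hu Hud. eapply Rle_trans; [apply Hback; try easy; try lra|apply Hquad; lra].
  apply Rle_trans with (2 := Hd2e). apply Rmult_le_compat_l; lra. }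
destruct (Rle_lt_or_eq_dec _ _ (forward_jump_ge _ _ _ Hs)) as [Hts| <-].
(* Right-scattered [t]: nearby points lie at or before [t], and the exact jump relation reduces the
   residual from [s] to the one from [t]. *)
- exists (Rmin d (s - t)). split; [apply Rmin_pos; lra|].
  pose proof (Rmin_l d (s - t)). pose proof (Rmin_r d (s - t)).
  intros u [Tu Hu0] Hu. apply Rabs_def2 in Hu.
  assert (Hut : u <= t).
  { destruct (Rle_dec u t); [easy|]. assert (s <= u) by (apply Hs; split; [easy|lra]). lra. }
  rewrite Rabs_pos_eq by lra.
  rewrite (H2 t s Tt ltac:(lra) Hs).
  replace (x t + lam * (s - t) * x t - x u - (s - u) * (lam * x t))%C
    with (x t - x u - (t - u) * (lam * x t))%C by ring.
  apply Rle_trans with (eps * (t - u)); [apply Hb2; try easy; lra|].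
  apply Rmult_le_compat_l; lra.
- exists d. split; [easy|]. intros u [Tu Hu0] Hu. apply Rabs_def2 in Hu.
  destruct (Rle_dec u t) as [Hut|Hut].
  + rewrite Rabs_pos_eq by lra. apply Hb2; try easy; lra.
  + rewrite <- Cmod_opp, Rabs_left by lra.
    replace (- (x t - x u - (t - u) * (lam * x t)))%C
      with (x u - x t - lam * (u - t) * x t)%C by ring.
    eapply Rle_trans; [apply HT3; try easy; lra|].
    replace (- (t - u)) with (u - t) by ring.
    apply Rle_trans with (P * (u - t) * (u - t)); [|apply Hquad; lra].
    apply Rmult_le_compat_r; [lra|]. apply Rmult_le_compat_r; lra.
Qed.

(** * Norms on complex vectors and coordinatewise derivatives *)

Lemma Cnorm2_Cmod z : Cnorm2 z = Cmod z * Cmod z.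
Proof.
unfold Cnorm2, Cmod. rewrite sqrt_sqrt; [ring|].
apply Rplus_le_le_0_compat; apply pow2_ge_0.
Qed.

Lemma sumR_ext n f g : (forall i, (i < n)%nat -> f i = g i) -> sumR n f = sumR n g.
Proof.
induction n as [|n IH]; intros H; simpl; [easy|].
rewrite IH, H; auto with arith.
Qed.

Lemma sumR_ge_0 n f : (forall i, (i < n)%nat -> 0 <= f i) -> 0 <= sumR n f.
Proof.
induction n as [|n IH]; intros H; simpl; [lra|].
apply Rplus_le_le_0_compat; auto with arith.
Qed.

Lemma sumR_term_le n f i : (forall j, (j < n)%nat -> 0 <= f j) -> (i < n)%nat ->
  f i <= sumR n f.
Proof.
induction n as [|n IH]; intros H Hi; simpl; [lia|].
assert (0 <= sumR n f) by (apply sumR_ge_0; auto with arith).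
destruct (Nat.eq_dec i n) as [->|]; [lra|].
assert (f i <= sumR n f) by (apply IH; [auto with arith|lia]).
assert (0 <= f n) by auto with arith. lra.
Qed.

Lemma sumR_le_const n f c : (forall i, (i < n)%nat -> f i <= c) -> sumR n f <= INR n * c.
Proof.
induction n as [|n IH]; intros H; [simpl; lra|].
rewrite S_INR. simpl. assert (sumR n f <= INR n * c) by auto with arith.
assert (f n <= c) by auto with arith. lra.
Qed.

Lemma sumR_scal n f c : sumR n (fun i => c * f i) = c * sumR n f.
Proof. induction n as [|n IH]; simpl; [ring|]. rewrite IH. ring. Qed.

Lemma vnorm_ext n v w : (forall i, (i < n)%nat -> v i = w i) -> vnorm n v = vnorm n w.
Proof. intros H. unfold vnorm. f_equal. apply sumR_ext. intros i Hi. now rewrite H. Qed.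

Lemma Cnorm2_ge_0 z : 0 <= Cnorm2 z.
Proof. rewrite Cnorm2_Cmod. apply Rmult_le_pos; apply Cmod_ge_0. Qed.

Lemma Cmod_le_vnorm n v i : (i < n)%nat -> Cmod (v i) <= vnorm n v.
Proof.
intros Hi. unfold vnorm. rewrite <- (sqrt_square (Cmod (v i))) by apply Cmod_ge_0.
rewrite <- Cnorm2_Cmod. apply sqrt_le_1_alt.
apply (sumR_term_le n (fun j => Cnorm2 (v j))); [|easy]. intros; apply Cnorm2_ge_0.
Qed.

Lemma vnorm_le_sumR n v : vnorm n v <= sumR n (fun i => Cmod (v i)).
Proof.
assert (0 <= sumR n (fun i => Cmod (v i))) by (apply sumR_ge_0; intros; apply Cmod_ge_0).
unfold vnorm. rewrite <- (sqrt_square (sumR n (fun i => Cmod (v i)))) by easy.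
apply sqrt_le_1_alt. clear H.
induction n as [|n IH]; simpl; [lra|].
assert (0 <= sumR n (fun i => Cmod (v i))) by (apply sumR_ge_0; intros; apply Cmod_ge_0).
rewrite Cnorm2_Cmod. pose proof (Cmod_ge_0 (v n)). nra.
Qed.

Lemma vnorm_scal n c v : vnorm n (fun i => (c * v i)%C) = Cmod c * vnorm n v.
Proof.
unfold vnorm. rewrite <- (sqrt_square (Cmod c)) at 1 by apply Cmod_ge_0.
rewrite <- sqrt_mult_alt by (apply Rmult_le_pos; apply Cmod_ge_0).
rewrite <- sumR_scal. f_equal. apply sumR_ext. intros i _.
rewrite !Cnorm2_Cmod, Cmod_mult. ring.
Qed.

Lemma vnorm_1 v : vnorm 1 v = Cmod (v 0%nat).
Proof.
unfold vnorm. simpl. rewrite Rplus_0_l, Cnorm2_Cmod. apply sqrt_square, Cmod_ge_0.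
Qed.

Lemma delta_deriv_residual (f : R -> vec) (a : vec) s st i :
  vsub (vsub (f st) (f s)) (vscale (st - s) a) i = (f st i - f s i - (st - s) * a i)%C.
Proof. rewrite <- RtoC_minus. reflexivity. Qed.

Lemma delta_deriv_component n T f t a i : (i < n)%nat ->
  delta_deriv n T f t a -> cderiv T (fun s => f s i) t (a i).
Proof.
intros Hi [st [Hs Hd]]. exists st. split; [easy|]. intros eps He.
destruct (Hd eps He) as [d [Hd1 Hd2]]. exists d. split; [easy|]. intros s Ts Hts.
eapply Rle_trans; [|apply (Hd2 s Ts Hts)]. rewrite <- delta_deriv_residual.
now apply Cmod_le_vnorm.
Qed.

Lemma delta_deriv_1 T f t a : cderiv T (fun s => f s 0%nat) t (a 0%nat) ->
  delta_deriv 1 T f t a.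
Proof.
intros [st [Hs Hd]]. exists st. split; [easy|]. intros eps He.
destruct (Hd eps He) as [d [Hd1 Hd2]]. exists d. split; [easy|]. intros s Ts Hts.
rewrite vnorm_1, delta_deriv_residual. now apply Hd2.
Qed.

Lemma delta_deriv_direction n T (y : R -> C) t a v :
  cderiv T y t a -> delta_deriv n T (fun s i => y s * v i)%C t (fun i => a * v i)%C.
Proof.
intros [st [Hs Hd]]. exists st. split; [easy|]. intros eps He.
assert (Hv : 0 <= vnorm n v) by apply sqrt_pos.
destruct (Hd (eps / (vnorm n v + 1))) as [d [Hd1 Hd2]]; [apply Rdiv_lt_0_compat; lra|].
exists d. split; [easy|]. intros s Ts Hts. specialize (Hd2 s Ts Hts).
rewrite (vnorm_ext n _ (fun i => ((y st - y s - (st - s) * a) * v i)%C)).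
2:{ intros i _.
  rewrite (delta_deriv_residual (fun s i => y s * v i)%C (fun i => a * v i)%C). Cring. }
rewrite vnorm_scal.
apply Rle_trans with (eps / (vnorm n v + 1) * Rabs (st - s) * (vnorm n v + 1)).
- apply Rmult_le_compat; try easy; [apply Cmod_ge_0|lra].
- right. field. lra.
Qed.

Lemma delta_deriv_ext n T f t a b : (forall i, (i < n)%nat -> a i = b i) ->
  delta_deriv n T f t a -> delta_deriv n T f t b.
Proof.
intros H [st [Hs Hd]]. exists st. split; [easy|]. intros eps He.
destruct (Hd eps He) as [d [Hd1 Hd2]]. exists d. split; [easy|]. intros s Ts Hts.
rewrite (vnorm_ext n _ (vsub (vsub (f st) (f s)) (vscale (st - s) a))); [auto|].
intros i Hi. rewrite !delta_deriv_residual, H; easy.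
Qed.

Lemma mulmxv_1 lam (v : vec) i : mulmxv 1 (fun _ _ => lam) v i = (lam * v 0%nat)%C.
Proof.
unfold mulmxv. simpl. Cring.
Qed.

(** Restarting later leaves the forward jump unchanged and only removes test points. *)
Lemma cderiv_from T s t0 t f a : s <= t0 <= t ->
  cderiv (Tfrom T s) f t a -> cderiv (Tfrom T t0) f t a.
Proof.
intros H [st [Hs Hd]]. exists st. split.
- apply forward_jump_from; [lra|]. apply forward_jump_from in Hs; [easy|lra].
- intros eps He. destruct (Hd eps He) as [d [Hd1 Hd2]]. exists d. split; [easy|].
  intros u [Tu Hu]. apply Hd2. split; [easy|lra].
Qed.

Lemma cderiv_ext T f g t a b : (forall s, f s = g s) -> a = b ->
  cderiv T f t a -> cderiv T g t b.
Proof.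
intros H <- [st [Hs Hd]]. exists st. split; [easy|]. intros eps He.
destruct (Hd eps He) as [d [Hd1 Hd2]]. exists d. split; [easy|].
intros u Tu Hu. rewrite <- !H. now apply Hd2.
Qed.

(** * Decay for the scalar equation, free and forced *)

(** By linearity the local bound on [V] becomes a bound for the solution starting at 1: scale it
    into [V] and cancel the factor. *)
Lemma stability_set_decay T lam : closedT T -> sup_infinite T -> stability_set T lam ->
  exists K alpha, 1 <= K /\ 0 < alpha /\ forall t0, T t0 ->
    exists phi : R -> C, phi t0 = RtoC 1 /\
      (forall t, T t -> t0 <= t -> cderiv (Tfrom T t0) phi t (lam * phi t)%C) /\
      forall t, T t -> t0 <= t -> Cmod (phi t) <= K * exp (- alpha * (t - t0)).
Proof.
intros HT Hsup [K [alpha [V [HK [Ha [HV [V0 Hst]]]]]]].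
exists K, alpha. split; [easy|]. split; [easy|]. intros t0 T0.
destruct (scalar_solution_exists T lam t0 HT Hsup T0) as [phi [H1 H2]].
exists phi. split; [easy|]. split; [easy|]. intros t Tt Ht.
destruct (HV _ V0) as [r [Hr HVr]].
(* Half the radius puts the initial value strictly inside the ball contained in [V]. *)
set (c := RtoC (r / 2)). assert (Hc : Cmod c = r / 2).
{ unfold c. rewrite Cmod_R, Rabs_pos_eq; lra. }
assert (H := Hst t0 t (fun _ => c) (fun s _ => c * phi s)%C T0 Tt Ht).
rewrite !vnorm_1, Cmod_mult, Hc in H.
apply Rmult_le_reg_l with (r / 2); [lra|].
replace (r / 2 * (K * exp (- alpha * (t - t0)))) with (K * exp (- alpha * (t - t0)) * (r / 2)) by ring.
apply H.
- apply HVr. rewrite vnorm_1.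
  change (vsub (fun _ => c) vzero 0%nat) with (c - 0)%C. replace (c - 0)%C with c by ring. lra.
- split.
  + intros i _. rewrite H1. Cring.
  + intros s [Ts Hs]. apply delta_deriv_1. rewrite mulmxv_1.
    apply cderiv_ext with (fun s => (c * phi s)%C) (c * (lam * phi s))%C; [easy|ring|].
    now apply cderiv_scal, H2.
Qed.

Lemma perturbed_growth T lam t0 t1 (z g : R -> C) G :
  closedT T -> T t0 -> T t1 -> t0 <= t1 -> 0 <= G ->
  (forall t, T t -> t0 <= t -> cderiv (Tfrom T t0) z t (lam * z t + g t)%C) ->
  (forall t, T t -> t0 <= t <= t1 -> Cmod (g t) <= G) ->
  Cmod (z t1) <= (Cmod (z t0) + G * (t1 - t0)) * exp (Cmod lam * (t1 - t0)).
Proof.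
intros HT T0 T1 H01 HG Hz Hg.
apply (gronwall T t0 t1 (fun t => Cmod (z t))); try easy; try apply Cmod_ge_0.
- intros a Ta Ha eta Heta.
  destruct (cderiv_right T t0 z a _ (proj1 Ha) Ta (Hz a Ta (proj1 Ha)) eta Heta)
    as [d [Hd Hb]].
  exists d. split; [easy|]. intros b Hn _. specialize (Hb b Hn). destruct Hn as [_ [Hab _]].
  eapply Rle_trans; [apply (Cmod_le_add3 _ (z a) ((b - a) * (lam * z a + g a))
    (z b - z a - (b - a) * (lam * z a + g a))); ring|].
  rewrite Cmod_mult, Cmod_RtoC_minus by lra.
  assert (Cmod (lam * z a + g a)%C <= Cmod lam * Cmod (z a) + G).
  { eapply Rle_trans; [apply Cmod_triangle|]. rewrite Cmod_mult.
    apply Rplus_le_compat_l. apply Hg; [easy|lra]. }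
  assert ((b - a) * Cmod (lam * z a + g a)%C <= (b - a) * (Cmod lam * Cmod (z a) + G))
    by (apply Rmult_le_compat_l; lra).
  lra.
- intros a Ta Ha eta Heta.
  destruct (cderiv_left_continuous T t0 z a _ ltac:(lra) Ta (Hz a Ta ltac:(lra)) eta Heta)
    as [d [Hd Hb]].
  exists d. split; [easy|]. intros b Tb Hb1 Hb2. specialize (Hb b Tb Hb1 Hb2).
  apply Rle_trans with (Cmod (z b) + Cmod (z a - z b)%C); [|lra]. apply Cmod_le_add. ring.
Qed.

(** Subtracting [y t0 * phi] leaves a solution of the forced equation that vanishes at [t0], to
    which the Gronwall bound applies. *)
Lemma perturbation_bound T lam s t0 t1 (phi y g : R -> C) G :
  closedT T -> T t0 -> T t1 -> s <= t0 <= t1 -> 0 <= G ->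
  phi t0 = RtoC 1 ->
  (forall t, T t -> t0 <= t -> cderiv (Tfrom T t0) phi t (lam * phi t)%C) ->
  (forall t, T t -> s <= t -> cderiv (Tfrom T s) y t (lam * y t + g t)%C) ->
  (forall t, T t -> t0 <= t <= t1 -> Cmod (g t) <= G) ->
  Cmod (y t1) <= Cmod (phi t1) * Cmod (y t0) +
    G * ((t1 - t0) * exp (Cmod lam * (t1 - t0))).
Proof.
intros HT T0 T1 H01 HG Hp0 Hphi Hy Hg.
set (z := fun t => (y t + - y t0 * phi t)%C).
assert (Hz0 : Cmod (z t0) = 0).
{ unfold z. rewrite Hp0, <- Cmod_0. f_equal. ring. }
assert (Hz : Cmod (z t1) <= (Cmod (z t0) + G * (t1 - t0)) * exp (Cmod lam * (t1 - t0))).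
{ apply perturbed_growth with T g; try easy. intros t Tt Ht.
  apply cderiv_ext with z (lam * y t + g t + - y t0 * (lam * phi t))%C; [easy|unfold z; ring|].
  apply cderiv_plus; [|now apply cderiv_scal, Hphi].
  apply cderiv_from with s; [lra|]. apply Hy; [easy|lra]. }
rewrite Hz0 in Hz.
eapply Rle_trans; [apply (Cmod_le_add _ (phi t1 * y t0) (z t1)); unfold z; ring|].
rewrite Cmod_mult. lra.
Qed.

(** Take the last point of [T] not beyond [u]: its forward jump is at least [u], so the gap is at
    most the graininess. *)
Lemma point_before T M t0 u : closedT T -> sup_infinite T ->
  (forall t s, T t -> forward_jump T t s -> s - t <= M) -> T t0 -> t0 <= u ->
  exists s, T s /\ t0 <= s <= u /\ u - s <= M.
Proof.
intros HT Hsup HM T0 Hu. destruct (sup_in_closed T t0 u HT T0 Hu) as [s [Ts [Hs Hmax]]].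
exists s. split; [easy|]. split; [easy|].
destruct (forward_jump_exists T s Hsup) as [s' Hs'].
assert (u <= s').
{ apply Hs'. intros b [Tb Hb]. destruct (Rle_dec u b); [easy|].
  specialize (Hmax b Tb ltac:(lra)). lra. }
specialize (HM s s' Ts Hs'). lra.
Qed.

(* Compare [y] over windows of length between [L] and [L + M] with the solution
   of the unforced equation restarted at the left end of the window: [L] is so
   long that the latter is halved, and bounded graininess provides the windows. *)
Lemma forced_decay T lam beta : closedT T -> sup_infinite T -> bounded_graininess T ->
  stability_set T lam -> 0 < beta ->
  exists A gamma, 0 <= A /\ 0 < gamma /\ forall t0 (y g : R -> C) N, T t0 -> 0 <= N ->
    (forall t, T t -> t0 <= t -> cderiv (Tfrom T t0) y t (lam * y t + g t)%C) ->
    Cmod (y t0) <= N ->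
    (forall t, T t -> t0 <= t -> Cmod (g t) <= N * exp (- beta * (t - t0))) ->
    forall t, T t -> t0 <= t -> Cmod (y t) <= A * N * exp (- gamma * (t - t0)).
Proof.
intros HT Hsup [M0 HM0] Hlam Hbeta.
destruct (stability_set_decay T lam HT Hsup Hlam) as [K [alpha [HK [Ha Hdec]]]].
pose proof (Cmod_ge_0 lam) as HL0.
set (M := Rmax 0 M0). assert (HMp : 0 <= M) by apply Rmax_l.
assert (HM : forall t s, T t -> forward_jump T t s -> s - t <= M).
{ intros t s Tt Hs. apply Rle_trans with (1 := HM0 t s Tt Hs), Rmax_r. }
(* Then [alpha * L = 2 * K], and [exp x >= 1 + x] makes [K * exp (- alpha * r)] at most 1/2 for
   [r >= L]. *)
set (L := 2 * K / alpha). assert (HL : 0 < L) by (apply Rdiv_lt_0_compat; lra).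
set (H := L + M). assert (HH : 0 < H) by (unfold H; lra).
set (C := H * exp (Cmod lam * H)).
assert (HC : 0 < C) by (apply Rmult_lt_0_compat; [easy|apply exp_pos]).
(* Since [gamma * H <= / 3], the target exponential shrinks at most by the factor 2/3 across a
   window; halving therefore still leaves a contraction by 3/4. *)
set (gamma := Rmin beta (/ (3 * H))).
assert (H3H : 0 < / (3 * H)) by (apply Rinv_0_lt_compat; lra).
assert (Hgam : 0 < gamma) by now apply Rmin_pos.
assert (Hgb : gamma <= beta) by apply Rmin_l.
assert (HgH : gamma * H <= / 3).
{ apply Rle_trans with (/ (3 * H) * H); [apply Rmult_le_compat_r; [lra|apply Rmin_r]|].
  right. field. lra. }
set (eb := exp (beta * H)). assert (Heb : 0 < eb) by apply exp_pos.
(* The first term covers the initial window. The second makes the forcing contribution [C * eb] at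
   most a quarter of [A], which complements the 3/4; [eb] is the cost of evaluating the forcing at
   the left end of a window. *)
set (A := 2 * (K + C) + 4 * C * eb).
assert (HA : 0 < A).
{ unfold A. assert (0 < C * eb) by now apply Rmult_lt_0_compat. lra. }
exists A, gamma. split; [lra|]. split; [easy|].
intros t0 y g N T0 HN Hy Hy0 Hg.
assert (Hexp_small : forall r, 0 <= r <= H -> exp (gamma * r) <= 3 / 2).
{ intros r Hr.
  assert (gamma * r <= gamma * H) by (apply Rmult_le_compat_l; lra).
  pose proof (exp_ineq1_le (- (gamma * r))). pose proof (exp_pos (gamma * r)).
  assert (exp (gamma * r) * exp (- (gamma * r)) = 1)
    by (rewrite <- exp_plus, Rplus_opp_r; apply exp_0).
  nra. }
assert (Hforce : forall r, 0 <= r <= H -> r * exp (Cmod lam * r) <= C).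
{ intros r Hr. apply Rmult_le_compat; try lra; [left; apply exp_pos|].
  apply exp_monotone, Rmult_le_compat_l; lra. }
assert (Hcase1 : forall t, T t -> t0 <= t -> t - t0 <= H ->
  Cmod (y t) <= A * N * exp (- gamma * (t - t0))).
{ intros t Tt Ht HtH. destruct (Hdec t0 T0) as [phi [Hp1 [Hp2 Hp3]]].
  assert (HB : Cmod (y t) <= Cmod (phi t) * Cmod (y t0) +
    N * ((t - t0) * exp (Cmod lam * (t - t0)))).
  { apply (perturbation_bound T lam t0 t0 t phi y g N); try easy; try lra.
    intros u Tu Hu. apply Rle_trans with (1 := Hg u Tu (proj1 Hu)).
    rewrite <- (Rmult_1_r N) at 2. apply Rmult_le_compat_l; [easy|].
    rewrite <- exp_0. apply exp_monotone. nra. }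
  assert (Hphi : Cmod (phi t) <= K).
  { apply Rle_trans with (1 := Hp3 t Tt Ht). rewrite <- (Rmult_1_r K) at 2.
    apply Rmult_le_compat_l; [lra|]. rewrite <- exp_0. apply exp_monotone. nra. }
  assert (HB2 : Cmod (y t) <= (K + C) * N).
  { assert (Cmod (phi t) * Cmod (y t0) <= K * N)
      by (apply Rmult_le_compat; try easy; apply Cmod_ge_0).
    assert (N * ((t - t0) * exp (Cmod lam * (t - t0))) <= N * C)
      by (apply Rmult_le_compat_l; [easy|apply Hforce; lra]).
    lra. }
  assert (He : 2 / 3 <= exp (- gamma * (t - t0))).
  { assert (gamma * (t - t0) <= gamma * H) by (apply Rmult_le_compat_l; lra).
    pose proof (exp_ineq1_le (- gamma * (t - t0))). lra. }
  apply Rle_trans with (1 := HB2).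
  apply Rle_trans with (A * N * (2 / 3)).
  - replace (A * N * (2 / 3)) with (2 / 3 * A * N) by ring. apply Rmult_le_compat_r; [easy|].
    unfold A. assert (0 < C * eb) by now apply Rmult_lt_0_compat. lra.
  - apply Rmult_le_compat_l; [apply Rmult_le_pos; lra|easy]. }
(* Each window has length at least [L], so going back to its left end lowers [k] by one. *)
assert (Hind : forall k t, T t -> t0 <= t -> t - t0 <= INR k * L ->
  Cmod (y t) <= A * N * exp (- gamma * (t - t0))).
{ induction k as [|k IH]; intros t Tt Ht Hk.
  - apply Hcase1; try easy. simpl in Hk. lra.
  - destruct (Rle_dec (t - t0) H) as [HtH|HtH]; [now apply Hcase1|].
    destruct (point_before T M t0 (t - L) HT Hsup HM T0) as [s [Ts [Hs HsM]]];
      [unfold H in HtH; lra|].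
    assert (Hts : L <= t - s <= H) by (unfold H; lra).
    rewrite S_INR in Hk.
    specialize (IH s Ts (proj1 Hs) ltac:(lra)).
    destruct (Hdec s Ts) as [phi [Hp1 [Hp2 Hp3]]].
    set (G := N * exp (- beta * (s - t0))).
    assert (HG : 0 <= G) by (apply Rmult_le_pos; [easy|left; apply exp_pos]).
    assert (HB : Cmod (y t) <= Cmod (phi t) * Cmod (y s) +
      G * ((t - s) * exp (Cmod lam * (t - s)))).
    { apply (perturbation_bound T lam t0 s t phi y g G); try easy; try lra.
      intros u Tu Hu. apply Rle_trans with (1 := Hg u Tu ltac:(lra)).
      apply Rmult_le_compat_l; [easy|]. apply exp_monotone.
      assert (beta * (s - t0) <= beta * (u - t0)) by (apply Rmult_le_compat_l; lra). lra. }
    assert (Hphi : Cmod (phi t) <= / 2).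
    { apply Rle_trans with (1 := Hp3 t Tt ltac:(lra)).
      assert (2 * K <= alpha * (t - s)).
      { replace (2 * K) with (alpha * L) by (unfold L; field; lra).
        apply Rmult_le_compat_l; lra. }
      pose proof (exp_ineq1_le (alpha * (t - s))).
      pose proof (exp_pos (- alpha * (t - s))).
      assert (exp (alpha * (t - s)) * exp (- alpha * (t - s)) = 1).
      { rewrite <- exp_plus, <- exp_0. f_equal. ring. }
      nra. }
    set (X := exp (- gamma * (t - t0))) in *. assert (HX : 0 < X) by apply exp_pos.
    assert (HXs : exp (- gamma * (s - t0)) <= X * (3 / 2)).
    { replace (- gamma * (s - t0)) with (- gamma * (t - t0) + gamma * (t - s)) by ring.
      rewrite exp_plus. apply Rmult_le_compat_l; [lra|]. apply Hexp_small. lra. }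
    assert (HGX : G <= N * (X * eb)).
    { unfold G. apply Rmult_le_compat_l; [easy|].
      unfold X, eb. rewrite <- exp_plus. apply exp_monotone.
      assert (beta * (t - s) <= beta * H) by (apply Rmult_le_compat_l; lra).
      assert (gamma * (t - t0) <= beta * (t - t0)) by (apply Rmult_le_compat_r; lra).
      lra. }
    assert (HAN : 0 <= A * N) by (apply Rmult_le_pos; lra).
    assert (H1 : Cmod (phi t) * Cmod (y s) <= / 2 * (A * N * (X * (3 / 2)))).
    { apply Rmult_le_compat; try easy; try apply Cmod_ge_0.
      apply Rle_trans with (1 := IH). now apply Rmult_le_compat_l. }
    assert (H2 : G * ((t - s) * exp (Cmod lam * (t - s))) <= N * (X * eb) * C).
    { apply Rmult_le_compat; try easy; [|apply Hforce; lra].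
      apply Rmult_le_pos; [lra|left; apply exp_pos]. }
    assert (H3 : 4 * C * eb * (N * X) <= A * (N * X)).
    { apply Rmult_le_compat_r; [apply Rmult_le_pos; lra|]. unfold A. lra. }
    lra. }
intros t Tt Ht. destruct (INR_unbounded ((t - t0) / L)) as [k Hk].
apply (Hind k); try easy.
replace (t - t0) with ((t - t0) / L * L) by (field; lra).
apply Rmult_le_compat_r; lra.
Qed.

(** * The chain of factors of the annihilating product *)

Lemma Cmod_mulmxv_le n M v N i : 0 <= N -> (i < n)%nat ->
  (forall j, (j < n)%nat -> Cmod (v j) <= N) ->
  Cmod (mulmxv n M v i) <= sumR n (fun k => sumR n (fun j => Cmod (M k j))) * N.
Proof.
intros HN Hi Hv.
apply Rle_trans with (sumR n (fun j => Cmod (M i j)) * N).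
- unfold mulmxv. clear Hi. induction n as [|n IH]; simpl.
  + rewrite Rmult_0_l. change Defs.C0 with (RtoC 0). rewrite Cmod_0. lra.
  + rewrite Rmult_plus_distr_r. eapply Rle_trans; [apply Cmod_triangle|].
    apply Rplus_le_compat; [auto with arith|].
    change (Cmul (M i n) (v n)) with (M i n * v n)%C. rewrite Cmod_mult.
    apply Rmult_le_compat_l; [apply Cmod_ge_0|auto with arith].
- apply Rmult_le_compat_r; [easy|].
  apply (sumR_term_le n (fun k => sumR n (fun j => Cmod (M k j)))); [|easy].
  intros j _. apply sumR_ge_0. intros; apply Cmod_ge_0.
Qed.

Lemma mulmxv_combination n M lam (v w : vec) i :
  mulmxv n M (fun j => Csub (v j) (Cmul lam (w j))) i =
  (mulmxv n M v i - lam * mulmxv n M w i)%C.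
Proof.
unfold mulmxv. induction n as [|n IH]; simpl.
- Cring.
- rewrite IH. Cring.
Qed.

Lemma cderiv_mulmxv n T (u : R -> vec) t M (a : vec) i : (i < n)%nat ->
  (forall j, (j < n)%nat -> cderiv T (fun s => u s j) t (a j)) ->
  cderiv T (fun s => mulmxv n M (u s) i) t (mulmxv n M a i).
Proof.
intros Hi H. unfold mulmxv.
apply (cderiv_sumC T (fun j s => Cmul (M i j) (u s j)) t _ n _ _ (H i Hi)).
intros j Hj. apply (cderiv_scal T (fun s => u s j)). now apply H.
Qed.

(** Induction on the list: [v = (M - lam) u] solves the same system, since [M] commutes with
    [M - lam], and is annihilated by the remaining factors. Each coordinate of [u] then solves a
    scalar equation forced by the decaying coordinate of [v]. *)
Lemma chain_decay T n M ls : closedT T -> sup_infinite T -> bounded_graininess T ->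
  (forall lam, List.In lam ls -> stability_set T lam) ->
  exists K gamma, 0 <= K /\ 0 < gamma /\ forall t0 (u : R -> vec) N, T t0 -> 0 <= N ->
    (forall t i, T t -> t0 <= t -> (i < n)%nat ->
       cderiv (Tfrom T t0) (fun s => u s i) t (mulmxv n M (u t) i)) ->
    (forall t i, T t -> t0 <= t -> (i < n)%nat ->
       fold_left (fun w lam => vshift n M lam w) ls (u t) i = Defs.C0) ->
    (forall i, (i < n)%nat -> Cmod (u t0 i) <= N) ->
    forall t i, T t -> t0 <= t -> (i < n)%nat ->
      Cmod (u t i) <= K * N * exp (- gamma * (t - t0)).
Proof.
intros HT Hsup Hgr. induction ls as [|lam ls IH]; intros Hls.
(* The empty product is the identity, so [u] itself vanishes. *)
- exists 0, 1. split; [lra|]. split; [lra|].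
  intros t0 u N T0 HN _ Hz _ t i Tt Ht Hi. specialize (Hz t i Tt Ht Hi). simpl in Hz.
  rewrite Hz. change Defs.C0 with (RtoC 0). rewrite Cmod_0. lra.
- destruct IH as [K [beta [HK [Hbeta IH]]]]; [intros; apply Hls; now right|].
  destruct (forced_decay T lam beta HT Hsup Hgr (Hls lam (or_introl eq_refl)) Hbeta)
    as [A [gamma [HA [Hgam Hdec]]]].
  set (B := sumR n (fun k => sumR n (fun j => Cmod (M k j))) + Cmod lam).
  assert (HB : 0 <= B).
  { apply Rplus_le_le_0_compat; [|apply Cmod_ge_0].
    apply sumR_ge_0; intros; apply sumR_ge_0; intros; apply Cmod_ge_0. }
  assert (HKB : 0 <= K * B) by now apply Rmult_le_pos.
  (* [forced_decay] wants one bound for initial value and forcing: [K * B] accounts for the forcing,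
     as [B * N] bounds [v] at [t0], and 1 for the initial value. *)
  exists (A * (K * B + 1)), gamma. split; [apply Rmult_le_pos; lra|]. split; [easy|].
  intros t0 u N T0 HN Hu Hz Hu0 t i Tt Ht Hi.
  set (v := fun s => vshift n M lam (u s)).
  assert (Hv : forall s j, T s -> t0 <= s -> (j < n)%nat ->
    Cmod (v s j) <= K * (B * N) * exp (- beta * (s - t0))).
  { apply IH; try easy; [now apply Rmult_le_pos| |].
    - intros s j Ts Hs Hj.
      apply cderiv_ext with (fun r => mulmxv n M (u r) j + - lam * u r j)%C
        (mulmxv n M (mulmxv n M (u s)) j + - lam * mulmxv n M (u s) j)%C.
      + intros r. change (v r j) with (mulmxv n M (u r) j - lam * u r j)%C. Cring.
      + unfold v, vshift. rewrite mulmxv_combination. Cring.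
      + apply cderiv_plus; [apply cderiv_mulmxv; auto|].
        apply (cderiv_scal _ (fun r => u r j)). auto.
    - intros j Hj. change (v t0 j) with (mulmxv n M (u t0) j - lam * u t0 j)%C.
      unfold B. rewrite Rmult_plus_distr_r.
      eapply Rle_trans; [apply Cmod_triangle|]. rewrite Cmod_opp, Cmod_mult.
      apply Rplus_le_compat; [now apply Cmod_mulmxv_le|].
      apply Rmult_le_compat_l; [apply Cmod_ge_0|auto]. }
  rewrite (Rmult_assoc A).
  assert (HKN : 0 <= K * B * N) by now apply Rmult_le_pos.
  apply (Hdec t0 (fun s => u s i) (fun s => v s i)); try easy.
  + apply Rmult_le_pos; lra.
  + intros s Ts Hs. apply cderiv_ext with (fun r => u r i) (mulmxv n M (u s) i); [easy| |auto].
    change (v s i) with (mulmxv n M (u s) i - lam * u s i)%C. Cring.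
  + specialize (Hu0 i Hi). lra.
  + intros s Ts Hs. apply Rle_trans with (1 := Hv s i Ts Hs Hi).
    apply Rmult_le_compat_r; [left; apply exp_pos|]. lra.
Qed.

(** * Both directions of the equivalence *)

Lemma UES_eigenvalue T n A lam : UES n T (mxRtoC A) -> eigenvalue n A lam ->
  stability_set T lam.
Proof.
intros [K [alpha [V [HK [Ha [HV [V0 Hst]]]]]]] [v [[i0 [Hi0 Hv0]] Hv]].
destruct (HV _ V0) as [r [Hr HVr]].
assert (Hvn : 0 < vnorm n v).
{ apply Rlt_le_trans with (Cmod (v i0)); [now apply Cmod_gt_0|now apply Cmod_le_vnorm]. }
(* The scalars whose multiple of [v] lies in the ball inside [V]; the norm of [v] then cancels from
   the estimate. *)
exists K, alpha, (fun w => Cmod (w 0%nat) * vnorm n v < r).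
split; [easy|]. split; [easy|]. split; [|split].
- intros w Hw. exists ((r - Cmod (w 0%nat) * vnorm n v) / vnorm n v).
  split; [apply Rdiv_lt_0_compat; lra|]. intros w' Hw'.
  rewrite vnorm_1 in Hw'. change (vsub w' w 0%nat) with (w' 0%nat - w 0%nat)%C in Hw'.
  apply (Rmult_lt_compat_r (vnorm n v)) in Hw'; [|easy].
  unfold Rdiv in Hw'. rewrite Rmult_assoc, Rinv_l in Hw' by lra.
  assert (Cmod (w' 0%nat) <= Cmod (w 0%nat) + Cmod (w' 0%nat - w 0%nat)%C)
    by (apply Cmod_le_add; Cring).
  apply (Rmult_le_compat_r (vnorm n v)) in H; lra.
- change (vzero 0%nat) with (RtoC 0). rewrite Cmod_0. lra.
- intros t0 t x0 x T0 Tt Ht Hx0 [Hx1 Hx2]. rewrite !vnorm_1.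
  assert (H := Hst t0 t (fun i => x0 0%nat * v i)%C (fun s i => x s 0%nat * v i)%C T0 Tt Ht).
  rewrite !vnorm_scal in H.
  apply Rmult_le_reg_r with (vnorm n v); [easy|]. rewrite (Rmult_assoc _ _ (vnorm n v)).
  apply H.
  + apply HVr. rewrite (vnorm_ext n _ (fun i => x0 0%nat * v i)%C); [now rewrite vnorm_scal|].
    intros i _. change (x0 0%nat * v i - 0 = x0 0%nat * v i)%C. Cring.
  + split; [intros i _; now rewrite Hx1 by lia|].
    intros s Hs.
    apply delta_deriv_ext with (fun i => (lam * x s 0%nat) * v i)%C.
    { intros i Hi. transitivity (x s 0%nat * mulmxv n (mxRtoC A) v i)%C.
      - rewrite Hv by easy. Cring.
      - unfold mulmxv. clear. induction n as [|n IH]; simpl.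
        + Cring.
        + rewrite <- IH. Cring. }
    apply delta_deriv_direction.
    rewrite <- (mulmxv_1 lam (x s) 0).
    apply (delta_deriv_component 1 _ x _ (mulmxv 1 (fun _ _ => lam) (x s))); [lia|].
    now apply Hx2.
Qed.

Theorem mainTheorem3 (T : R -> Prop) (n : nat) (A : mxR) :
  time_scale T -> sup_infinite T -> bounded_graininess T ->
  (UES n T (mxRtoC A) <->
   (forall lam, eigenvalue n A lam -> stability_set T lam)).
Proof.
intros [_ HT] Hsup Hgr. split.
- intros H lam Hlam. now apply UES_eigenvalue with n A.
- intros Hspec.
  destruct (CayleyHamilton.annihilating_eigenvalues n A) as [ls [Hls Hann]].
  destruct (chain_decay T n (mxRtoC A) ls HT Hsup Hgr) as [K [gamma [HK [Hgam Hdec]]]];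
    [intros lam Hlam; now apply Hspec, Hls|].
  assert (HnK : 0 <= INR n * K) by (apply Rmult_le_pos; [apply pos_INR|easy]).
  (* The bound is global, so the neighbourhood is the whole space. The factor [INR n] pays for
     passing from coordinates to the norm, and the 1 keeps the constant at least 1 even when [n] or
     [K] is 0. *)
  exists (INR n * K + 1), gamma, (fun _ => True).
  split; [lra|]. split; [easy|]. split; [intros v _; exists 1; split; [lra|easy]|].
  split; [easy|]. intros t0 t x0 x T0 Tt Ht _ [Hx1 Hx2].
  apply Rle_trans with (1 := vnorm_le_sumR n (x t)).
  assert (HN : 0 <= vnorm n x0) by apply sqrt_pos.
  pose proof (exp_pos (- gamma * (t - t0))) as He.
  apply Rle_trans with (INR n * (K * vnorm n x0 * exp (- gamma * (t - t0)))).
  + apply sumR_le_const. intros i Hi. apply (Hdec t0 x); try easy.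
    * intros s j Ts Hs Hj.
      apply (delta_deriv_component n _ x _ (mulmxv n (mxRtoC A) (x s))); [easy|].
      now apply Hx2.
    * intros s j Ts Hs Hj. now apply Hann.
    * intros j Hj. rewrite Hx1 by easy. now apply Cmod_le_vnorm.
  + assert (0 <= exp (- gamma * (t - t0)) * vnorm n x0) by (apply Rmult_le_pos; lra).
    lra.
Qed.
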